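(* Let $\mathbf{k}$ be a field of characteristic zero, let $B\in\mathcal M(\mathbf{k})$, and let $X=\operatorname{Spec} B$. Then the set $$\operatorname{Sing}(X)=\{\,\mathfrak p\in\operatorname{Spec} B \mid B_{\mathfrak p}\ \text{is not a regular local ring}\,\}$$ is finite. Consequently, $B$ is regular in codimension $1$.
   Context: For a $\mathbf{k}$-domain $B$ (an integral domain containing $\mathbf{k}$), a derivation $D:B\to B$ is locally nilpotent if for each $b\in B$ there is a natural number $n$ (depending on $b$) with $D^n(b)=0$; $\mathrm{LND}(B)$ denotes the set of locally nilpotent derivations of $B$ (including $0$). The Makar-Limanov invariant of $B$ is $\mathrm{ML}(B)=\bigcap_{D\in\mathrm{LND}(B)}\ker D$. $\mathcal M(\mathbf{k})$ is the class of $2$-dimensional affine (i.e. finitely generated) $\mathbf{k}$-domains $B$ with $\mathrm{ML}(B)=\mathbf{k}$. ''$B$ is regular in codimension $1$'' means that $B_{\mathfrak p}$ is regular for every height $1$ prime ideal $\mathfrak p$ of $B$. The field $\mathbf{k}$ is not assumed algebraically closed. *)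

(* Defs.v *)
From HB Require Import structures.
From mathcomp Require Import all_boot all_order all_algebra.
From mathcomp Require Import generic_quotient ring_quotient fraction.
From mathcomp Require Import boolp classical_sets cardinality.

Set Implicit Arguments.
Unset Strict Implicit.
Unset Printing Implicit Defensive.

Import GRing.Theory.
Local Open Scope ring_scope.
Local Open Scope classical_set_scope.

Notation Spec R := (prime_idealr R).

(* Points of [Spec R] are determined by their elements, so that finiteness of a
   [set (Spec R)] has its usual meaning. *)
Lemma Spec_ext (R : comNzRingType) (p q : Spec R) : p =i q -> p = q.
Proof.
destruct p as [p cp], q as [q cq]; rewrite /= => pq.
have {}pq : p = q by apply/funext => x; exact: pq.
subst q; congr PrimeIdealr.Pack.
destruct cp as [a b c d], cq as [a' b' c' d']; congr PrimeIdealr.Class.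
all: match goal with |- ?x = ?y => destruct x as [u], y as [v] end.
all: by rewrite (Prop_irrelevance u v).
Qed.

Section Ideals.
Variable R : comNzRingType.

Definition prime_chain (n : nat) (p : nat -> Spec R) : Prop :=
  forall i, (i < n)%N ->
    {subset p i <= p i.+1} /\ ~ {subset p i.+1 <= p i}.

Definition krull_dim (n : nat) : Prop :=
  (exists p, prime_chain n p) /\
  forall m p, prime_chain m p -> (m <= n)%N.

Definition height (q : Spec R) (n : nat) : Prop :=
  (exists p, prime_chain n p /\ p n =i q) /\
  forall m p, prime_chain m p -> p m =i q -> (m <= n)%N.

Definition generates (s : seq R) (I : {pred R}) : Prop :=
  forall x, x \in I <-> exists c : 'I_(size s) -> R, x = \sum_i c i * s`_i.

Definition min_generators (I : {pred R}) (n : nat) : Prop :=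
  (exists s, generates s I /\ size s = n) /\
  forall s, generates s I -> (n <= size s)%N.

(* [idealr R] is the type of proper ideals; the unit ideal is generated by 1. *)
Definition noetherian : Prop :=
  forall I : idealr R, exists s, generates s I.

Definition maximal_ideal (m : idealr R) : Prop :=
  forall J : idealr R, {subset m <= J} -> J =i m.

Definition is_local_with (m : idealr R) : Prop :=
  maximal_ideal m /\ forall m' : idealr R, maximal_ideal m' -> m' =i m.

Definition regular_local_ring : Prop :=
  noetherian /\
  exists (m : idealr R) (n : nat),
    [/\ is_local_with m, krull_dim n & min_generators m n].

End Ideals.

(* Since B is a domain, its localization at p is realized as the subring
   { a / s | s \notin p } of the field of fractions. *)
Section Localization.
Variables (B : idomainType) (p : Spec B).

Definition in_localization : {pred {fraction B}} :=
  fun x => `[< exists a s : B, s \notin p /\ x = tofrac a / tofrac s >].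

Lemma in_localization_subring : subring_closed in_localization.
Proof.
have nz (s : B) : s \notin p -> tofrac s != 0.
  by move=> sp; rewrite tofrac_eq0; apply: contraNneq sp => ->; exact: idealr0.
split.
- apply/asboolP; exists 1, 1; split; first by rewrite idealr1.
  by rewrite divr1 rmorph1.
- move=> _ _ /asboolP[a [s [sp ->]]] /asboolP[b [t [tp ->]]].
  apply/asboolP; exists (a * t - b * s), (s * t); split.
    by rewrite prime_idealrM negb_or sp.
  by rewrite -mulNr addf_div ?nz// -rmorphN -!rmorphM -rmorphD mulNr.
- move=> _ _ /asboolP[a [s [sp ->]]] /asboolP[b [t [tp ->]]].
  apply/asboolP; exists (a * b), (s * t); split.
    by rewrite prime_idealrM negb_or sp.
  by rewrite mulf_div -!rmorphM.
Qed.

HB.instance Definition _ :=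
  GRing.isSubringClosed.Build {fraction B} in_localization
    in_localization_subring.

Record localization :=
  Localization { loc_val : {fraction B}; _ : loc_val \in in_localization }.

HB.instance Definition _ := [isSub for loc_val].
HB.instance Definition _ := [Choice of localization by <:].
HB.instance Definition _ :=
  [SubChoice_isSubComNzRing of localization by <:].

End Localization.

Definition Sing (B : idomainType) : set (Spec B) :=
  [set p | ~ regular_local_ring (localization p)].

Definition regular_in_codim1 (B : idomainType) : Prop :=
  forall p : Spec B, height p 1 -> regular_local_ring (localization p).

(* Derivations are not required to be linear over a base field. *)
Definition is_derivation (B : idomainType) (D : {additive B -> B}) : Prop :=
  forall a b, D (a * b) = D a * b + a * D b.

Definition LND (B : idomainType) : set {additive B -> B} :=
  [set D | is_derivation D /\ forall b, exists n, iter n D b = 0].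

Definition ML (B : idomainType) : set B :=
  \bigcap_(D in @LND B) [set b | D b = 0].

Arguments Sing B : clear implicits.
Arguments LND B : clear implicits.
Arguments ML B : clear implicits.

(* The k-algebra structure of B is given by a ring morphism iota : k -> B, which
   is injective since k is a field and B is nontrivial. *)
Definition affine (k : fieldType) (B : idomainType)
    (iota : {rmorphism k -> B}) : Prop :=
  exists s : seq B, forall S : {pred B}, subring_closed S ->
    (forall a, iota a \in S) -> {subset s <= S} -> forall b, b \in S.

Definition class_M (k : fieldType) (B : idomainType)
    (iota : {rmorphism k -> B}) : Prop :=
  [/\ affine iota, krull_dim B 2 & ML B = range iota].

(* Main.v *)
Require Import Defs.
From mathcomp Require Import all_boot all_order all_algebra.
From mathcomp Require Import ring_quotient fraction.
From mathcomp Require Import boolp classical_sets cardinality.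
From HB Require Import structures.
From mathcomp Require Import generic_quotient fieldext.
From Stdlib Require Ring_polynom InitialRing Ring_theory BinInt.

(** Let [D] be a nonzero locally nilpotent derivation of [B], with kernel [A], and let [s]
    be a slice: [D s] is a nonzero element of [A]. After inverting [D s], the ring [B]
    is the ring of polynomials in [s] over [A] ([slice_expansion]); since [B] has dimension two, [A]
    has transcendence degree one over [k] ([kernel_algebraic]). Because the Makar-Limanov
    invariant is [k], there are two such derivations [D] and [E] with different kernels
    ([exists_LND]).

    The theorem rests on one fact ([height_one_kernels]): a prime [p] of height one cannot
    contain both a nonzero [x] with [D x = 0] and a nonzero [y] with [E y = 0].
    Geometrically, a curve in the surface cannot be contained in a fiber of both fibrations
    by affine lines defined by the two kernels. Suppose that it is, and move from that curve
    towards infinity along the fiber of [x]. The function [y] vanishes on the curve but has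
    a pole at infinity, so that somewhere in between there is a valuation for which [x] is
    still small and [y] is a transcendental residue. The general fiber of [y] is a line
    on which [x] is a nonconstant polynomial, so it only goes to infinity where [x] does;
    hence the valuation has a center on the surface. This center contains the curve and lies
    in [x = 0], but not in [y = 0]: it is strictly larger than the curve and yet not
    the whole surface, which contradicts the height of [p]. Algebraically, one starts from a
    valuation [v] centered at [p] ([chevalley]) and from the exponential
    [exp (TD) : B -> B[T]]; the intermediate valuations are the Gauss valuations of [B[T]]
    for the various weights of [T], and the weight is chosen so that [y] gets
    valuation zero ([slope_valuation_ring], [kernels_separate]).

    Regularity in codimension one follows. A prime [p] of height one meets the kernel of
    [D] or that of [E] in zero, and then the local ring at [p] is a localization of
    the polynomials in a slice over the fraction field of that kernel
    ([kernel_avoiding_principal]).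

    For finiteness, one finds a nonzero [a] in [A] such that [B] is regular at every prime
    of height two that does not contain [a] ([kernel_regular_locus]): in
    characteristic zero, [A] is unramified over [k[x]] away from the zeros of such an element,
    which provides one generator for a prime of [A] and, with the slice, two for
    a prime of [B] ([local_generators_adjoin_simple], [local_generators_adjoin]). The singular
    primes therefore contain an element [a] of the kernel of [D] and an element [c] of the
    kernel of [E]. As no prime of height one contains both, they are minimal over [(a, c)], and
    a noetherian ring has finitely many such primes ([finite_minimal_primes]). *)

Set Implicit Arguments.
Unset Strict Implicit.
Unset Printing Implicit Defensive.

Import GRing.Theory.
Local Open Scope ring_scope.
Local Open Scope classical_set_scope.

(** * Commutative ring identities by reflection *)

Section RingReflection.
Variable R : comNzRingType.
Let radd : R -> R -> R := +%R.
Let rmul : R -> R -> R := *%R.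
Let rsub (x y : R) : R := x - y.
Let ropp : R -> R := -%R.

Lemma comNzRing_theory : Ring_theory.ring_theory 0 1 radd rmul rsub ropp eq.
Proof.
split=> //=.
- exact: add0r.
- exact: addrC.
- exact: addrA.
- exact: mul1r.
- exact: mulrC.
- exact: mulrA.
- exact: mulrDl.
- exact: subrr.
Qed.

Definition ring_eval (l : seq R) (e : Ring_polynom.PExpr BinNums.Z) : R :=
  Ring_polynom.PEeval 0 1 radd rmul rsub ropp
    (InitialRing.gen_phiZ 0 1 radd rmul ropp) Ring_theory.id_phi_N (Ring_theory.pow_N 1 rmul) l e.

Definition ring_norm (e : Ring_polynom.PExpr BinNums.Z) : Ring_polynom.Pol BinNums.Z :=
  Ring_polynom.norm_subst BinNums.Z0 (BinNums.Zpos BinNums.xH) BinInt.Z.add BinInt.Z.mul BinInt.Z.sub BinInt.Z.opp BinInt.Z.eqb BinInt.Z.quotrem O nil e.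

Lemma ring_norm_eq l (e1 e2 : Ring_polynom.PExpr BinNums.Z) :
  Ring_polynom.Peq BinInt.Z.eqb (ring_norm e1) (ring_norm e2) = true ->
  ring_eval l e1 = ring_eval l e2.
Proof.
have Rsth := RelationClasses.eq_equivalence (A := R).
have Reqe := Ring_theory.Eq_ext radd rmul ropp.
have Rth := comNzRing_theory; have ARth := Ring_theory.Rth_ARth Rsth Reqe Rth.
have Zm := InitialRing.gen_phiZ_morph Rsth Reqe Rth.
have dv := InitialRing.Ztriv_div_th Rsth (InitialRing.gen_phiZ 0 1 radd rmul ropp).
exact: (Ring_polynom.ring_correct Rsth Reqe ARth Zm (Ring_theory.pow_N_th _ _ Rsth) dv O l [::] e1 e2 I).
Qed.
End RingReflection.

(** Atoms are compared up to conversion, because the same element may be reached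
    through different paths of the structure hierarchy. *)
Ltac ring_atom x l :=
  lazymatch l with
  | nil => constr:((BinNums.xH, cons x nil))
  | cons ?y ?l' =>
    let same := match goal with
      | _ => let _ := match goal with _ => unify x y end in constr:(true)
      | _ => constr:(false) end in
    lazymatch same with
    | true => constr:((BinNums.xH, l))
    | false => lazymatch ring_atom x l' with
               | (?i, ?l'') => let i' := eval compute in (BinPos.Pos.succ i) in
                               constr:((i', cons y l'')) end
    end
  end.

Ltac ring_reify t l :=
  let binary C a b :=
    lazymatch ring_reify a l with (?ea, ?l1) =>
    lazymatch ring_reify b l1 with (?eb, ?l2) => constr:((C ea eb, l2)) end end in
  lazymatch t with
  | @GRing.add _ ?a (@GRing.opp _ ?b) => binary (@Ring_polynom.PEsub BinNums.Z) a b
  | @GRing.add _ ?a ?b => binary (@Ring_polynom.PEadd BinNums.Z) a b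
  | @GRing.mul _ ?a ?b => binary (@Ring_polynom.PEmul BinNums.Z) a b
  | @GRing.opp _ ?a =>
    lazymatch ring_reify a l with (?ea, ?l1) => constr:((Ring_polynom.PEopp ea, l1)) end
  | @GRing.zero _ => constr:((@Ring_polynom.PEO BinNums.Z, l))
  | @GRing.one _ => constr:((@Ring_polynom.PEI BinNums.Z, l))
  | _ => lazymatch ring_atom t l with (?i, ?l1) => constr:((@Ring_polynom.PEX BinNums.Z i, l1)) end
  end.

Ltac ring_eq :=
  lazymatch goal with |- @eq ?T ?a ?b =>
    lazymatch ring_reify a (@nil T) with (?ea, ?l1) =>
    lazymatch ring_reify b l1 with (?eb, ?l) =>
    refine (@ring_norm_eq _ l ea eb _); vm_compute; reflexivity
  end end end.

(** * Subrings, ideals and polynomials with coefficients in a subset *)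

Section Subrings.
Variable R : comNzRingType.
Implicit Types (S J : set R).

Definition subring S :=
  [/\ S 1, forall x y, S x -> S y -> S (x - y)
         & forall x y, S x -> S y -> S (x * y)].

(** Closure of [J] under addition and under multiplication by [S]; for
    [S = setT] these are the ideals of [R], the unit ideal included. *)
Definition is_ideal S J :=
  [/\ J 0, forall x y, J x -> J y -> J (x + y)
         & forall a x, S a -> J x -> J (a * x)].

Definition is_prime S J := [/\ is_ideal S J, J `<=` S, ~ J 1
  & forall x y, S x -> S y -> J (x * y) -> J x \/ J y].

Lemma is_idealN S J x : subring S -> is_ideal S J -> J x -> J (- x).
Proof.
move=> [S1 SB _] [_ _ JM] Jx; rewrite -mulN1r; apply: JM => //.
by rewrite -[- 1]add0r -[0](subrr 1); apply: (SB) => //; apply: (SB).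
Qed.

Lemma is_ideal_sum S J n (F : 'I_n -> R) :
  is_ideal S J -> (forall i, J (F i)) -> J (\sum_i F i).
Proof. by move=> [J0 JD _] JF; elim/big_ind: _. Qed.

Section Closure.
Variable S : set R.
Hypothesis HS : subring S.

Lemma subring1 : S 1. Proof. by case: HS. Qed.
Lemma subringB x y : S x -> S y -> S (x - y). Proof. by case: HS => _ /(_ x y). Qed.
Lemma subringM x y : S x -> S y -> S (x * y). Proof. by case: HS => _ _ /(_ x y). Qed.
Lemma subring0 : S 0. Proof. by rewrite -(subrr 1); apply: subringB; exact: subring1. Qed.
Lemma subringN x : S x -> S (- x).
Proof. by move=> Sx; rewrite -sub0r; apply: subringB => //; exact: subring0. Qed.
Lemma subringD x y : S x -> S y -> S (x + y).
Proof. by move=> Sx Sy; rewrite -[y]opprK; apply/subringB/subringN. Qed.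
Lemma subringX x n : S x -> S (x ^+ n).
Proof.
move=> Sx; elim: n => [|n IHn]; first by rewrite expr0; exact: subring1.
by rewrite exprS; exact: subringM.
Qed.
Lemma subring_nat n : S n%:R.
Proof.
elim: n => [|n IHn]; first exact: subring0.
by rewrite mulrS; apply: subringD => //; exact: subring1.
Qed.
Lemma subring_is_ideal : is_ideal S S.
Proof. by split; [exact: subring0|exact: subringD|exact: subringM]. Qed.
End Closure.
End Subrings.

Section Span.
Variable R : comNzRingType.
Implicit Types S P : set R.

Inductive span S P : R -> Prop :=
| span0 : span S P 0
| spanD c x y : S c -> P x -> span S P y -> span S P (c * x + y).

Lemma span_ideal S P : subring S -> is_ideal S (span S P).
Proof.
move=> HS; split; first exact: span0.
- move=> x y; elim=> [|c u v Sc Pu _ IH] Jy; first by rewrite add0r.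
  by rewrite -addrA; apply: spanD => //; exact: IH.
- move=> a x Sa; elim=> [|c u v Sc Pu _ IH]; first by rewrite mulr0; exact: span0.
  by rewrite mulrDr mulrA; apply: spanD => //; exact: subringM.
Qed.

Lemma span_gen S P x : subring S -> P x -> span S P x.
Proof.
move=> HS Px; rewrite -[x]mul1r -[_ * _]addr0; apply: spanD => //; last exact: span0.
exact: subring1.
Qed.

Lemma span_sub S P : subring S -> P `<=` S -> span S P `<=` S.
Proof.
move=> HS PS x; elim=> [|c u v Sc Pu _ IH]; first exact: subring0.
by apply: (subringD HS) => //; apply: (subringM HS) => //; exact: PS.
Qed.

Lemma span_min S P J : is_ideal S J -> P `<=` J -> span S P `<=` J.
Proof.
move=> [J0 JD JM] PJ x; elim=> // c u v Sc Pu _ Jv.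
by apply: JD => //; apply: JM => //; exact: PJ.
Qed.

Lemma span_mono S S' P P' : S `<=` S' -> P `<=` P' -> span S P `<=` span S' P'.
Proof.
move=> SS' PP' x; elim=> [|c u v Sc Pu _ IH]; first exact: span0.
by apply: spanD => //; [exact: SS'|exact: PP'].
Qed.

End Span.

Section Coefficients.
Variable R : comNzRingType.
Implicit Types (S J : set R) (p q : {poly R}).

Definition coefs_in S : set {poly R} := [set p | forall i, S p`_i].

Definition adjoin S c : set R := [set b | exists2 q, coefs_in S q & b = q.[c]].

Lemma subring_horner S q c : subring S -> coefs_in S q -> S c -> S q.[c].
Proof.
move=> HS Sq Sc; rewrite horner_coef; apply: (is_ideal_sum (subring_is_ideal HS)) => i.
by apply: (subringM HS) => //; exact: subringX.
Qed.

Lemma coefs_inC S c : S 0 -> S c -> coefs_in S c%:P.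
Proof. by move=> S0 Sc i; rewrite coefC; case: (i == 0)%N. Qed.

Lemma coefs_inXn S n : subring S -> coefs_in S 'X^n.
Proof. by move=> HS i; rewrite coefXn; exact: subring_nat. Qed.

Lemma coefs_inX S : subring S -> coefs_in S 'X.
Proof. by move=> HS i; rewrite coefX; exact: subring_nat. Qed.

Lemma coefs_in_ideal S J : is_ideal S J ->
  is_ideal (coefs_in S) (coefs_in J).
Proof.
move=> JI; have [J0 JD JM] := JI; split=> [i|p q Jp Jq i|a p Sa Jp i].
- by rewrite coef0.
- by rewrite coefD; exact: JD.
- rewrite coefM; apply: (is_ideal_sum JI) => j; exact: JM.
Qed.

Lemma coefs_in_subring S : subring S -> subring (coefs_in S).
Proof.
move=> HS; have [c0 cD cM] := coefs_in_ideal (subring_is_ideal HS).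
split=> //; first by apply: coefs_inC; [exact: subring0|exact: subring1].
by move=> p q Sp Sq i; rewrite coefB; exact: subringB.
Qed.

Lemma adjoin_subring S c : subring S -> subring (adjoin S c).
Proof.
move=> HS; have HP := coefs_in_subring HS; split.
- by exists 1; [exact: (subring1 HP)|rewrite hornerC].
- move=> _ _ [p Sp ->] [q Sq ->]; exists (p - q); last by rewrite hornerD hornerN.
  exact: (subringB HP).
- move=> _ _ [p Sp ->] [q Sq ->]; exists (p * q); last by rewrite hornerM.
  exact: (subringM HP).
Qed.

Lemma adjoin_sub S c : subring S -> S `<=` adjoin S c.
Proof.
by move=> HS x Sx; exists x%:P; [apply: coefs_inC => //; exact: subring0|rewrite hornerC].
Qed.

Lemma adjoin_gen S c : subring S -> adjoin S c c.
Proof. by move=> HS; exists 'X; [exact: coefs_inX|rewrite hornerX]. Qed.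

Lemma adjoin_min S T c : subring T -> S `<=` T -> T c -> adjoin S c `<=` T.
Proof.
move=> HT ST Tc _ [q Sq ->]; apply: (subring_horner HT) => // i; exact/ST/Sq.
Qed.

End Coefficients.

Lemma setT_subring (R : comNzRingType) : subring (@setT R).
Proof. by []. Qed.
#[global] Hint Resolve setT_subring : core.

(** * Valuation rings and Chevalley's extension theorem *)

Section Valuations.
Variable K : fieldType.
Implicit Types (O S J P : set K).

Definition valuation_ring O := subring O /\ forall x, O x \/ O x^-1.

Definition max_ideal O : set K := [set x | x = 0 \/ ~ O x^-1].

(** Polynomials in [u] whose coefficients lie in the ideal are closed under
    multiplication by polynomials over [S]. *)
Lemma span_adjoin S P u : subring S ->
  span (adjoin S u) P `<=` adjoin (span S P) u.
Proof.
move=> HS x; have JI := span_ideal P HS; have [J0 JD JM] := coefs_in_ideal JI.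
elim=> [|_ z v [p Sp ->] Pz _ [q Jq ->]]; first by exists 0; rewrite ?horner0.
exists (p * z%:P + q); last by rewrite hornerD hornerM hornerC.
apply: (JD) => //; apply: (JM) => //; apply: coefs_inC; first exact: span0.
exact: span_gen.
Qed.

Section Maximal.
Variables (O P : set K).
Hypotheses (HO : subring O) (PO : P `<=` O) (O_proper : ~ span O P 1).
Hypothesis O_max : forall u, ~ O u -> adjoin (span O P) u 1.
Let J := span O P.
Let JI : is_ideal O J := span_ideal P HO.
Let JO : J `<=` O := span_sub HO PO.

Lemma pow_one_sub j n : J j -> exists2 i, J i & (1 - j) ^+ n = 1 - i.
Proof.
have [J0 JD JM] := JI => Jj; elim: n => [|n [i Ji E]].
  by exists 0; rewrite ?expr0 ?subr0.
exists (i + (1 - i) * j); last by rewrite exprSr E; ring_eq.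
apply: (JD) => //; apply: (JM) => //; apply: (subringB HO) (JO Ji).
exact: subring1.
Qed.

(** Otherwise [1] would be a polynomial in [(1 - j)^-1] with coefficients in the
    ideal; clearing denominators puts a power of [1 - j], which is congruent to [1],
    into the ideal. *)
Lemma one_sub_unit j : J j -> O (1 - j)^-1.
Proof.
move=> Jj; have [J0 JD JM] := JI; apply: contrapT => /O_max[q Jq E].
have nz : 1 - j != 0.
  by apply/eqP => /(canRL (subrK _)); rewrite add0r => E1; apply: O_proper; rewrite E1.
have O1j : O (1 - j) by apply: (subringB HO) (JO Jj); exact: subring1.
have [i Ji Ei] := pow_one_sub (size q) Jj.
suff J1i : J (1 - i) by apply: O_proper; rewrite -[1](subrK i); exact: JD.
rewrite -Ei -[_ ^+ _]mulr1 [X in _ * X]E horner_coef mulr_sumr.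
apply: (is_ideal_sum JI) => k; rewrite mulrCA mulrC; apply: (JM) => //.
by rewrite exprVn -expfB //; exact: subringX.
Qed.

(** Descent on the degrees: the relation of lower degree, solved for its constant
    term, expresses a power of [u] by lower powers and so cancels the leading term
    of the other relation. *)
Lemma no_relation_pair n m (q r : {poly K}) (u : K) : u != 0 ->
  (size q <= n)%N -> (size r <= m)%N -> coefs_in J q -> coefs_in J r ->
  1 = q.[u] -> 1 = r.[u^-1] -> False.
Proof.
have [N leN] := ubnP (n + m); elim: N n m q r u leN => // N IH n m q r u.
wlog lemn : n m q r u / (m <= n)%N.
  move=> W leN u0 sq sr Jq Jr Eq Er; case: (leqP m n) => [le|/ltnW le].
    by apply: (W n m q r u).
  by apply: (W m n r q u^-1) => //; rewrite ?invrK ?invr_eq0 // addnC.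
rewrite ltnS => leN u0 sq sr Jq Jr Eq Er; have [J0 JD JM] := JI.
case: m sr lemn leN => [|[|m]] sr lemn leN.
- by move: Er sr; rewrite leqn0 size_poly_eq0 => Er /eqP r0; move: Er; rewrite r0 horner0 => /eqP; rewrite oner_eq0.
- by apply: O_proper; rewrite Er (size1_polyC sr) hornerC; exact: Jr.
case: n sq lemn leN => [//|n] sq lemn leN.
have Ov := one_sub_unit (Jr 0%N); set v := (_)^-1 in Ov.
have v0 : 1 - r`_0 != 0.
  apply/eqP => /(canRL (subrK _)); rewrite add0r => E1; apply: O_proper; rewrite E1.
  exact: Jr.
(* [r] rewritten as [u ^+ m.+1 = t.[u]] with [t] of degree at most [m] *)
pose t := \sum_(i < m.+1) (v * r`_i.+1) *: 'X^(m - i).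
have Jt : coefs_in J t.
  move=> k; rewrite coef_sum; apply: (is_ideal_sum JI) => i.
  rewrite coefZ mulrAC; apply: (JM); last exact: Jr.
  apply: (subringM HO) => //; exact: coefs_inXn.
have st : (size t <= m.+1)%N.
  apply/(leq_trans (size_sum _ _ _))/bigmax_leqP => i _.
  by apply: leq_trans (size_scale_leq _ _) _; rewrite size_polyXn ltnS leq_subr.
have Et : u ^+ m.+1 = t.[u].
  have Er' : 1 - r`_0 = \sum_(i < m.+1) r`_i.+1 * u^-1 ^+ i.+1.
    rewrite {1}Er (horner_coef_wide _ sr) big_ord_recl expr0 mulr1 addrC addKr.
    by apply: eq_bigr.
  rewrite horner_sum -[LHS]mul1r -(mulVf v0) -/v Er' mulr_sumr mulr_suml.
  apply: eq_bigr => i _; rewrite hornerZ hornerXn -!mulrA; congr (_ * (_ * _)).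
  by rewrite exprVn mulrC -(subSS i m) expfB_cond // (negbTE u0) ltn_ord.
pose q' := (q - q`_n *: 'X^n) + q`_n *: ('X^(n - m.+1) * t).
have lemn' : (m.+1 <= n)%N by rewrite -ltnS.
apply: (IH n m.+2 q' r u) => //.
- apply/leq_sizeP => k lek; rewrite coefD coefB !coefZ coefXn coefXnM.
  have -> : (if (k < n - m.+1)%N then 0 else t`_(k - (n - m.+1))) = 0.
    case: ifP => // _; apply/(leq_sizeP _ m.+1) => //.
    by rewrite leq_subRL ?(leq_trans (leq_subr _ _) lek) // subnK.
  rewrite mulr0 addr0; case: eqVneq => [->|ne]; first by rewrite mulr1 subrr.
  rewrite mulr0 subr0; apply/(leq_sizeP _ n.+1) => //.
  by rewrite ltn_neqAle eq_sym ne.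
- have JC := coefs_in_ideal JI; have [_ cD cM] := JC.
  have JZ c p : J c -> coefs_in O p -> coefs_in J (c *: p).
    move=> Jc Op; rewrite -mul_polyC mulrC; apply: (cM) => //.
    by apply: coefs_inC.
  apply: (cD); last apply: JZ => //.
    apply: (cD) => //; apply: (is_idealN (coefs_in_subring HO) JC); apply: JZ => //.
    exact: coefs_inXn.
  apply: (subringM (coefs_in_subring HO)); first exact: coefs_inXn.
  by move=> i; exact/JO/Jt.
- by rewrite !(hornerE, hornerXn) -Et /= -mulrA -exprD subnK // subrK.
Qed.

Lemma maximal_valuation_ring : valuation_ring O.
Proof.
split=> // u; apply: contrapT => /not_orP[nu nv].
have u0 : u != 0 by apply/eqP => E; apply: nu; rewrite E; exact: subring0.
have [q Jq Eq] := O_max nu; have [r Jr Er] := O_max nv.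
exact: (no_relation_pair u0 (leqnn _) (leqnn _) Jq Jr Eq Er).
Qed.

Lemma sub_max_ideal : J `<=` max_ideal O.
Proof.
move=> x Jx; have [->|x0] := eqVneq x 0; first by left.
right=> Ox; apply: O_proper; rewrite -(mulVf x0); have [_ _ JM] := JI; exact: JM.
Qed.

End Maximal.

(** Zorn's lemma, applied to the subrings in which [P] generates a proper ideal.
    The empty set is added to the family so that empty chains have a bound. *)
Lemma dominating_valuation_ring (R P : set K) : subring R -> P `<=` R ->
  ~ span R P 1 ->
  exists O, [/\ valuation_ring O, R `<=` O & P `<=` max_ideal O].
Proof.
move=> HR PR R_proper.
pose good S := [/\ subring S, R `<=` S & ~ span S P 1].
pose fam : set (set K) := [set S | S = set0 \/ good S].
have chain F : F `<=` fam -> total_on F subset -> fam (\bigcup_(X in F) X).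
  move=> Ff Ft; pose F' X := F X /\ good X.
  case: (pselect (exists X, F' X)) => [[X0 [FX0 gX0]]|no]; last first.
    left; rewrite -subset0 => x [X FX Xx]; case: (Ff X FX) => [X0|gX].
      by move: Xx; rewrite X0.
    by apply: no; exists X.
  right; have common X Y : F X -> F Y -> exists2 Z, F Z & X `<=` Z /\ Y `<=` Z.
    move=> FX FY; case: (Ft X Y FX FY) => XY.
      by exists Y => //; split.
    by exists X => //; split.
  have ne X x : F X -> X x -> good X.
    by move=> FX Xx; case: (Ff X FX) => // X0'; move: Xx; rewrite X0'.
  have op (f : K -> K -> K) : (forall X x y, good X -> X x -> X y -> X (f x y)) ->
      forall x y, (\bigcup_(X in F) X) x -> (\bigcup_(X in F) X) y ->
        (\bigcup_(X in F) X) (f x y).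
    move=> Hf x y [X FX Xx] [Y FY Yy]; have [Z FZ [XZ YZ]] := common X Y FX FY.
    by exists Z => //; apply: Hf; [apply: (ne Z x) => //; exact: XZ|exact: XZ|exact: YZ].
  split.
  - split; first by exists X0 => //; case: gX0 => /subring1.
      by apply: op => X x y [HX _ _]; exact: subringB.
    by apply: op => X x y [HX _ _]; exact: subringM.
  - by move=> x Rx; exists X0 => //; case: gX0 => _ /(_ x Rx).
  - have fin x : span (\bigcup_(X in F) X) P x -> exists2 X, F' X & span X P x.
      elim=> [|c u v [X FX Xc] Pu _ [Y [FY gY] Jv]].
        by exists X0 => //; exact: span0.
      have [Z FZ [XZ YZ]] := common X Y FX FY.
      exists Z; first by split=> //; apply: (ne Z c) => //; exact: XZ.
      apply: spanD => //; first exact: XZ.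
      by elim: Jv => [|c' u' v' Sc' Pu' _ IH]; [exact: span0|apply: spanD => //; exact: YZ].
    by move=> /fin[X [_ [_ _ gX]]].
have [A [fA A_max]] := Zorn_bigcup chain.
have gR : good R by split.
have gA : good A.
  case: fA => // A0; exfalso; apply: (A_max R); last by right.
  split; first by rewrite A0 => ? [].
  by rewrite A0 => /(_ 1); apply; case: gR => /subring1.
have [HA RA A_proper] := gA; have PA : P `<=` A by move=> x /PR /RA.
have Amax u : ~ A u -> adjoin (span A P) u 1.
  move=> nu; apply: contrapT => n1; apply: (A_max (adjoin A u)).
    split; first exact: adjoin_sub.
    by move=> /(_ u); move=> H; apply/nu/H; exact: adjoin_gen.
  right; split; first exact: adjoin_subring.
    by move=> x /RA; exact: adjoin_sub.
  by move=> /span_adjoin; move=> /(_ HA).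
exists A; split=> //; first exact: maximal_valuation_ring PA A_proper Amax.
by move=> x Px; apply: (sub_max_ideal HA A_proper); exact: span_gen.
Qed.

(** Chevalley: localize at [P], then dominate the local ring obtained. *)
Lemma chevalley (R P : set K) : subring R -> is_prime R P ->
  exists O, [/\ valuation_ring O, R `<=` O &
    forall r, R r -> max_ideal O r <-> P r].
Proof.
move=> HR [PI PR nP1 Pprime]; have [P0 PD PM] := PI.
pose RP x := exists a s, [/\ R a, R s, ~ P s & x = a / s].
have nz s : ~ P s -> s != 0 by move=> nPs; apply/eqP => E; apply: nPs; rewrite E.
have nM s t : R s -> R t -> ~ P s -> ~ P t -> ~ P (s * t).
  by move=> Rs Rt ns nt /(Pprime _ _ Rs Rt) [].
have RRP : R `<=` RP.
  by move=> x Rx; exists x, 1; split; rewrite ?divr1 //; exact: subring1.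
have HRP : subring RP.
  split; first by apply: RRP; exact: subring1.
  - move=> _ _ [a [s [Ra Rs ns ->]]] [b [t [Rb Rt nt ->]]].
    exists (a * t - b * s), (s * t); split; last by rewrite -mulNr addf_div ?nz // mulNr.
    + by apply: subringB => //; exact: subringM.
    + exact: subringM.
    + exact: nM.
  - move=> _ _ [a [s [Ra Rs ns ->]]] [b [t [Rb Rt nt ->]]].
    exists (a * b), (s * t); split; last by rewrite mulf_div.
    + exact: subringM.
    + exact: subringM.
    + exact: nM.
have [|O [vO RPO PO]] := @dominating_valuation_ring RP P HRP (subset_trans PR RRP).
  have fr x : span RP P x -> exists a s, [/\ P a, R s, ~ P s & x = a / s].
    elim=> [|_ u v [a [s [Ra Rs ns ->]]] Pu _ [b [t [Pb Rt nt ->]]]].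
      by exists 0, 1; split; rewrite ?mul0r //; exact: subring1.
    exists (t * (a * u) + s * b), (s * t); split; last by rewrite mulrAC addf_div ?nz // [t * _]mulrC [s * b]mulrC.
    + by apply: PD; apply: (PM) => //; exact: (PM).
    + exact: subringM.
    + exact: nM.
  move=> /fr[a [s [Pa _ ns /esym/(canRL (divfK (nz _ ns)))]]].
  by rewrite mul1r => E; apply: ns; rewrite -E.
exists O; split=> //; first by move=> x /RRP /RPO.
move=> r Rr; split; last exact: PO.
move=> Mr; apply: contrapT => nr; case: Mr => [r0|]; first by apply: nr; rewrite r0.
apply; apply: RPO; exists 1, r; split=> //; first exact: subring1.
by rewrite mul1r.
Qed.

End Valuations.

(** * Gauss valuations *)

(** Gauss: in a product, look at the coefficient where the first coefficients
    outside [J] meet. *)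
Lemma coefs_in_prime (R : comNzRingType) (S J : set R) :
  subring S -> is_prime S J -> is_prime (coefs_in S) (coefs_in J).
Proof.
move=> HS [JI JS nJ1 Jprime]; have [J0 JD JM] := JI; split.
- exact: coefs_in_ideal.
- by move=> p Jp i; apply: JS.
- by move=> /(_ 0%N); rewrite coefC.
move=> p q Sp Sq Jpq; apply: contrapT => /not_orP[np nq].
have low (r : {poly R}) : ~ coefs_in J r ->
    exists2 m, ~ J r`_m & forall i, (i < m)%N -> J r`_i.
  move=> nr; have ex : exists i, `[< ~ J r`_i >].
    by apply: contrapT => H; apply: nr => i; apply: contrapT => n; apply: H; exists i; exact/asboolP.
  case: (ex_minnP ex) => m /asboolP nm mmin; exists m => // i im.
  apply: contrapT => ni; have /mmin : `[< ~ J r`_i >] by apply/asboolP.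
  by rewrite leqNgt im.
have [m nm mlow] := low p np; have [n nn nlow] := low q nq.
suff /Jprime[] : J (p`_m * q`_n) by [].
have lt : (m < (m + n).+1)%N by rewrite ltnS leq_addr.
have := Jpq (m + n)%N; rewrite coefM (bigD1 (Ordinal lt)) //= addKn.
set s := \sum_(i < _ | _) _ => Jps.
have Js : J s.
  rewrite /s; elim/big_ind: _ => // i ne; case: (ltnP i m) => im.
    by rewrite mulrC; apply: (JM) => //; exact: mlow.
  apply: (JM) => //; apply: nlow; rewrite ltn_subLR; last by rewrite -ltnS.
  rewrite ltn_add2r ltn_neqAle im andbT; apply: contra ne => /eqP E.
  exact/eqP/val_inj.
by rewrite -[_ * _](addrK s); apply: (JD) => //; exact: (is_idealN HS JI).
Qed.

Section ValuationRings.
Variables (K : fieldType) (O : set K).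
Hypothesis vO : valuation_ring O.
Let M := max_ideal O.
Let HO : subring O := proj1 vO.

Lemma max_ideal_sub : M `<=` O.
Proof. by move=> x [->|nx]; [exact: subring0|case: (proj2 vO x)]. Qed.

Lemma notin_valuation_ring x : ~ O x -> M x^-1.
Proof. by move=> nx; right; rewrite invrK. Qed.

Lemma notin_max_ideal x : ~ M x -> x != 0 /\ O x^-1.
Proof. by move=> /not_orP[/eqP x0 /contrapT Ox]. Qed.

Lemma max_ideal_prime : is_prime O M.
Proof.
have MM a x : O a -> M x -> M (a * x).
  move=> Oa [->|nx]; first by left; rewrite mulr0.
  have [->|a0] := eqVneq a 0; first by left; rewrite mul0r.
  by right=> Oax; apply: nx; rewrite -[_^-1](mulVKf a0) -invfM; exact: subringM.
have nM1 : ~ M 1.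
  by move=> [/eqP|]; rewrite ?oner_eq0 // invr1; apply; exact: subring1.
split=> //.
- split; [by left| |exact: MM].
  have half x y : y != 0 -> O (x / y) -> M y -> M (x + y).
    move=> y0 Oxy My; have -> : x + y = (x / y + 1) * y by rewrite mulrDl mul1r divfK.
    apply: MM => //.
    by apply: (subringD HO) => //; exact: subring1.
  move=> x y Mx My; have [->|x0] := eqVneq x 0; first by rewrite add0r.
  have [->|y0] := eqVneq y 0; first by rewrite addr0.
  case: (proj2 vO (x / y)) => [|]; first by move=> H; exact: half.
  by rewrite invf_div => H; rewrite addrC; apply: half.
- exact: max_ideal_sub.
move=> x y Ox Oy Mxy; apply: contrapT => /not_orP[/notin_max_ideal[x0 Vx] /notin_max_ideal[y0 Vy]].
apply: nM1; rewrite -(mulVf (mulf_neq0 x0 y0)); apply: MM => //.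
by rewrite invfM; exact: subringM.
Qed.

Let MI : is_ideal O M. Proof. by case: max_ideal_prime. Qed.

Lemma valuation_ring_root x n : (0 < n)%N -> O (x ^+ n) -> O x.
Proof.
case: n => // n _ Oxn; apply: contrapT => nx.
have Mx := notin_valuation_ring nx; apply: nx.
have [->|x0] := eqVneq x 0; first exact: subring0.
have -> : x = x ^+ n.+1 * x^-1 ^+ n.
  by rewrite exprS -mulrA -exprMn mulfV // expr1n mulr1.
by apply: (subringM HO) => //; apply: (subringX HO); exact: max_ideal_sub.
Qed.

Lemma dominant_entry (s : seq K) : has (fun x => x != 0) s ->
  exists e, [/\ e \in s, e != 0 & forall z, z \in s -> O (z / e)].
Proof.
elim: s => //= a s IH; case: (boolP (has _ s)) => [/IH[e [es e0 He]] _|no].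
  case: (proj2 vO (a / e)) => [Oa|]; last rewrite invf_div => Oa.
    exists e; split; rewrite ?inE ?es ?orbT // => z; rewrite inE => /orP[/eqP->//|].
    exact: He.
  have [a0|a0] := eqVneq a 0.
    exists e; split; rewrite ?inE ?es ?orbT // => z; rewrite inE => /orP[/eqP->|/He//].
    by rewrite a0 mul0r; exact: subring0.
  exists a; split; rewrite ?inE ?eqxx // => z; rewrite inE => /orP[/eqP->|/He Oz].
    by rewrite divff //; exact: subring1.
  by rewrite -[z](divfK e0) -[_ * e / a]mulrA; exact: subringM.
rewrite orbF => a0; exists a; split; rewrite ?inE ?eqxx // => z.
rewrite inE => /orP[/eqP->|zs]; first by rewrite divff //; exact: subring1.
have -> : z = 0 by apply: contraNeq no => z0; apply/hasP; exists z.
by rewrite mul0r; exact: subring0.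
Qed.

Lemma primitive_part (p : {poly K}) : p != 0 ->
  exists e q, [/\ e != 0, p = e *: q, coefs_in O q & ~ coefs_in M q].
Proof.
move=> p0; have [|e [es e0 He]] := @dominant_entry p.
  by apply/hasP; exists (lead_coef p); rewrite ?lead_coef_eq0 // mem_nth // prednK // size_poly_gt0.
exists e, (e^-1 *: p); split=> //.
- by rewrite scalerA divff // scale1r.
- move=> i; rewrite coefZ mulrC; case: (ltnP i (size p)) => [lt|le].
    by apply: He; exact: mem_nth.
  by rewrite nth_default // mul0r; exact: subring0.
move=> /(_ (index e p)); rewrite coefZ nth_index // mulVf //.
by case: max_ideal_prime.
Qed.

(** If the content [e] of [p] were not in [O], dividing the relation by [e ^+ n.+1] would
    put the product [a * q ^+ n.+1], with [q] primitive, into the maximal ideal. *)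
Lemma gauss_integral (a p : {poly K}) n (c : nat -> {poly K}) :
  coefs_in O a -> ~ coefs_in M a -> (forall i, coefs_in O (c i)) ->
  a * p ^+ n.+1 = \sum_(i < n.+1) c i * p ^+ i -> coefs_in O p.
Proof.
move=> Oa nMa Oc E; have [->|p0] := eqVneq p 0.
  by move=> i; rewrite coef0; exact: subring0.
have [e [q [e0 Ep Oq nMq]]] := primitive_part p0.
have OP := coefs_in_subring HO; have MP := coefs_in_prime HO max_ideal_prime.
have [MPI _ _ MPprime] := MP.
case: (pselect (O e)) => [Oe|/notin_valuation_ring Me].
  by move=> i; rewrite Ep coefZ; exact: subringM.
suff : coefs_in M (a * q ^+ n.+1).
  case/MPprime => //; first exact: (subringX OP).
  elim: (n.+1) => [|m IH]; first by case: MP => _ _ H _ /H.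
  by rewrite exprS => /MPprime[] //; exact: (subringX OP).
have -> : a * q ^+ n.+1 = \sum_(i < n.+1) (c i * q ^+ i) * (e^-1 ^+ (n.+1 - i))%:P.
  have eX : e ^+ n.+1 != 0 by rewrite expf_neq0.
  apply: (scalerI eX); rewrite scaler_sumr.
  transitivity (a * p ^+ n.+1); first by rewrite Ep exprZn scalerAr.
  rewrite E; apply: eq_bigr => i _; rewrite Ep exprZn -scalerAr.
  rewrite [(_ * _) * _%:P]mulrC mul_polyC scalerA; congr (_ *: _).
  rewrite -{2}(subnK (ltnW (ltn_ord i))) exprD mulrAC -exprMn mulfV //.
  by rewrite expr1n mul1r.
apply: (is_ideal_sum MPI) => i; have [_ _ PM] := MPI; apply: (PM).
  by apply: (subringM OP) => //; exact: (subringX OP).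
apply: coefs_inC; first by left.
have [k ->] : exists k, (n.+1 - i = k.+1)%N.
  by exists (n - i)%N; rewrite subSn // -ltnS.
have [_ _ MM] := MI; rewrite exprSr; apply: (MM) => //.
by apply: (subringX HO); exact: max_ideal_sub.
Qed.

Lemma valuation_ring_integral (a x : K) n (c : nat -> K) :
  O a -> ~ M a -> (forall i, O (c i)) ->
  a * x ^+ n.+1 = \sum_(i < n.+1) c i * x ^+ i -> O x.
Proof.
move=> Oa nMa Oc E; have O0 := subring0 HO.
suff : coefs_in O x%:P by move=> /(_ 0%N); rewrite coefC.
apply: (@gauss_integral a%:P _ n (fun i => (c i)%:P)).
- exact: coefs_inC.
- by move=> /(_ 0%N); rewrite coefC.
- by move=> i; exact: coefs_inC.
rewrite -rmorphXn -rmorphM E rmorph_sum; apply: eq_bigr => i _.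
by rewrite rmorphM rmorphXn.
Qed.

End ValuationRings.

Lemma irreducible_factor (F : fieldType) (p : {poly F}) : (1 < size p)%N ->
  exists2 q, irreducible_poly q & q %| p.
Proof.
have [n] := ubnP (size p); elim: n p => // n IH p lt p1.
case: (pselect (irreducible_poly p)) => [irr|nirr]; first by exists p.
have [q [sq qp nqp]] : exists q : {poly F}, [/\ size q != 1%N, q %| p & ~ q %= p].
  apply: contrapT => no; apply: nirr; split=> // q sq qp; apply: contrapT => nqp.
  by apply: no; exists q.
have p0 : p != 0 by rewrite -size_poly_gt0 ltnW.
have q0 : q != 0 by apply: contraNneq p0 => q0; move: qp; rewrite q0 dvd0p.
have sqp : (size q < size p)%N.
  rewrite ltn_neqAle dvdp_leq // andbT; apply/negP => s.
  by apply: nqp; rewrite -(dvdp_size_eqp qp).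
have lt1 : (size q < n)%N by rewrite -ltnS (leq_trans _ lt).
have lt2 : (1 < size q)%N by rewrite ltn_neqAle eq_sym sq size_poly_gt0.
have [r irr rq] := IH q lt1 lt2.
by exists r => //; exact: dvdp_trans rq qp.
Qed.

Lemma adjoin_nth_root (F : fieldType) (a : F) n : (0 < n)%N ->
  exists (L : fieldType) (f : {rmorphism F -> L}) (c : L), c ^+ n = f a.
Proof.
move=> n0; have [|q irr qp] := @irreducible_factor F ('X^n - a%:P).
  by rewrite size_XnsubC // ltnS.
have [L _ [z rz _]] := irredp_FAdjoin irr.
exists L, (in_alg L), z; apply/eqP; rewrite -subr_eq0.
have := dvdpP _ _ qp => -[r Er].
have : root (map_poly (in_alg L) ('X^n - a%:P)) z by rewrite Er rmorphM rootM rz orbT.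
by rewrite rmorphB rmorphXn /= map_polyX map_polyC /root !(hornerE, hornerXn).
Qed.

(** * Locally nilpotent derivations *)

Definition algebraic_over (R : comNzRingType) (S : set R) (b : R) :=
  exists q : {poly R}, [/\ coefs_in S q, q != 0 & q.[b] = 0].

Lemma algebraic_over_sub (R : comNzRingType) (S T : set R) b :
  S `<=` T -> algebraic_over S b -> algebraic_over T b.
Proof. by move=> ST [q [Sq q0 qb]]; exists q; split=> // i; exact/ST/Sq. Qed.

Lemma algebraic_over_coef0 (R : idomainType) (S : set R) b : b != 0 ->
  algebraic_over S b -> exists q, [/\ coefs_in S q, q`_0 != 0 & q.[b] = 0].
Proof.
move=> b0 [q []]; elim/poly_ind: q => [|r c IH] Sq q0; first by rewrite eqxx in q0.
have Er i : (r * 'X + c%:P)`_i.+1 = r`_i by rewrite coefD coefMX coefC addr0.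
have [c0|c0] := eqVneq c 0; last first.
  move=> qb; exists (r * 'X + c%:P); split=> //.
  by rewrite coefD coefMX coefC add0r.
rewrite c0 addr0 hornerM hornerX => /eqP; rewrite mulf_eq0 (negbTE b0) orbF => /eqP rb.
apply: IH => //; first by move=> i; rewrite -Er; exact: Sq.
by apply: contraNneq q0 => ->; rewrite c0 mul0r addr0.
Qed.

Section Derivations.
Variables (B : idomainType) (D : {additive B -> B}).
Hypothesis D_LND : LND B D.

Definition kernel : set B := [set b | D b = 0].

Let DM a b : D (a * b) = D a * b + a * D b. Proof. exact: (proj1 D_LND). Qed.

Lemma derivation1 : D 1 = 0.
Proof. by have := DM 1 1; rewrite !mulr1 mul1r -{1}[D 1]addr0 => /addrI. Qed.

Lemma kernel_subring : subring kernel.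
Proof.
split; first exact: derivation1.
- by move=> x y Dx Dy; rewrite /kernel /= raddfB Dx Dy subrr.
- by move=> x y Dx Dy; rewrite /kernel /= DM Dx Dy mul0r mulr0 addr0.
Qed.

Lemma derivation_kerM a b : kernel a -> D (a * b) = a * D b.
Proof. by move=> Da; rewrite DM Da mul0r add0r. Qed.

Lemma iter_kerM n a b : kernel a -> iter n D (a * b) = a * iter n D b.
Proof. by move=> Da; elim: n => //= n ->; exact: derivation_kerM. Qed.

Lemma iterB n a b : iter n D (a - b) = iter n D a - iter n D b.
Proof. by elim: n => //= n ->; rewrite raddfB. Qed.

Lemma derivation_horner (q : {poly B}) b : coefs_in kernel q ->
  D q.[b] = q^`().[b] * D b.
Proof.
elim/poly_ind: q => [|r c IH] Dq; first by rewrite deriv0 !horner0 raddf0 mul0r.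
have Er i : (r * 'X + c%:P)`_i.+1 = r`_i by rewrite coefD coefMX coefC addr0.
have Dc : D c = 0 by have := Dq 0%N; rewrite coefD coefMX coefC add0r.
have {}IH : D r.[b] = r^`().[b] * D b by apply: IH => i; rewrite -Er; exact: Dq.
rewrite derivD derivC addr0 derivM derivX mulr1 !hornerD !hornerM hornerX hornerC.
rewrite raddfD /= Dc addr0 DM IH. by ring_eq.
Qed.

Lemma derivation_exp b n : D (b ^+ n) = b ^+ n.-1 * D b *+ n.
Proof.
have := @derivation_horner 'X^n b; rewrite derivXn hornerXn hornerMn hornerXn mulrnAl.
by apply; apply: coefs_inXn; exact: kernel_subring.
Qed.

Hypothesis char0 : forall n, n.+1%:R != 0 :> B.

Lemma fact_char0 n : n`!%:R != 0 :> B.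
Proof. by rewrite -(prednK (fact_gt0 n)). Qed.

Lemma deriv_char0_eq0 (q : {poly B}) : q^`() = 0 -> (size q <= 1)%N.
Proof.
move=> q'; apply/leq_sizeP => [] [//|n] _; apply/eqP.
have /eqP := congr1 (fun p : {poly B} => p`_n) q'.
by rewrite coef_deriv coef0 -mulr_natr mulf_eq0 (negbTE (char0 n)) orbF.
Qed.

(** A relation of minimal degree is destroyed by applying [D] to it. *)
Lemma kernel_algebraically_closed b : algebraic_over kernel b -> kernel b.
Proof.
move=> [q []]; have [n] := ubnP (size q); elim: n q => // n IH q lt Dq q0 qb.
case: (eqVneq (D b) 0) => [//|Db0]; apply: (IH q^`()).
- by rewrite (leq_trans (lt_size_deriv q0)) // -ltnS.
- move=> i; rewrite coef_deriv -mulr_natr; apply: (subringM kernel_subring) => //.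
  exact: (subring_nat kernel_subring).
- apply: contraNneq q0 => /deriv_char0_eq0/size1_polyC E.
  by move: qb; rewrite E hornerC => ->.
by have /esym/eqP := derivation_horner b Dq; rewrite qb raddf0 mulf_eq0 (negbTE Db0) orbF => /eqP.
Qed.

Lemma local_slice b : D b != 0 -> exists s, D s != 0 /\ kernel (D s).
Proof.
move=> Db; have ex : exists n, iter n D b == 0.
  by case: (proj2 D_LND b) => n E; exists n; exact/eqP.
case: (ex_minnP ex) => [] [|[|n]] /= E nmin.
- by move: Db; rewrite (eqP E) raddf0 eqxx.
- by rewrite E in Db.
exists (iter n D b); split; last exact/eqP.
by apply/negP => /(nmin n.+1); rewrite ltnn.
Qed.

Lemma iter_slice s n i : kernel (D s) -> (i <= n)%N ->
  iter i D (s ^+ n) = (n ^_ i)%:R * D s ^+ i * s ^+ (n - i).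
Proof.
move=> Ds; elim: i => [|i IH] lt /=; first by rewrite subn0 ffactn0 !mul1r.
rewrite IH 1?ltnW // derivation_kerM; last first.
  apply: (subringM kernel_subring); first exact: (subring_nat kernel_subring).
  exact: (subringX kernel_subring).
by rewrite derivation_exp ffactnSr -subnS exprSr natrM -[_ *+ (n - i)]mulr_natr; ring_eq.
Qed.

(** If [D^(n+1) b = 0], then subtracting [D^n b * s^n] from [n! (D s)^n b] lowers the
    order of nilpotency. *)
Lemma slice_expansion s b : kernel (D s) -> exists m M q,
  coefs_in kernel q /\ m.+1%:R * D s ^+ M * b = q.[s].
Proof.
move=> Ds; have [n] := proj2 D_LND b; elim: n b => [|n IH] b /= E.
  by exists 0%N, 0%N, 0; split; [move=> i; rewrite coef0 /kernel /= raddf0|rewrite E mulr0 horner0].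
set u := iter n D b in E; have HK := kernel_subring; set a := D s in Ds *.
have Kan : kernel (n`!%:R * a ^+ n).
  by apply: (subringM HK); [exact: (subring_nat HK)|exact: (subringX HK)].
have [|m [M [q [Kq Eq]]]] := IH (n`!%:R * a ^+ n * b - u * s ^+ n).
  rewrite iterB !iter_kerM // iter_slice // ffactnn subnn expr0 mulr1 -/u -/a.
  by rewrite mulrC subrr.
exists (m.+1 * n`!).-1, (M + n)%N, (q + (m.+1%:R * a ^+ M * u) *: 'X^n); split.
  move=> i; rewrite coefD coefZ; apply: (subringD HK) => //.
  apply: (subringM HK); last exact: coefs_inXn.
  apply: (subringM HK) => //; apply: (subringM HK); first exact: (subring_nat HK).
  exact: (subringX HK).
rewrite prednK ?muln_gt0 ?fact_gt0 // hornerD hornerZ hornerXn -Eq natrM exprD.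
by ring_eq.
Qed.

(** ** The exponential of a multiple of [D] *)

Section Exponential.
Variables (L : fieldType) (f : {rmorphism B -> L}) (c : L).

Definition nilpotency_index b := proj1_sig (cid (proj2 D_LND b)).

Definition exp_coef b i : L := c ^+ i * f (iter i D b) / i`!%:R.

(** The image of [b] under the exponential of the derivation [c T D]. *)
Definition exp_poly b : {poly L} := \poly_(i < nilpotency_index b) exp_coef b i.

Lemma coef_exp_poly b i : (exp_poly b)`_i = exp_coef b i.
Proof.
rewrite coef_poly; case: ltnP => // le; rewrite /exp_coef.
suff -> : iter i D b = 0 by rewrite rmorph0 mulr0 mul0r.
rewrite /nilpotency_index in le; case: (cid _) le => n /= E le.
rewrite -(subnK le) iterD E; elim: (i - n)%N => //= j ->; exact: raddf0.
Qed.

Lemma exp_polyB a b : exp_poly (a - b) = exp_poly a - exp_poly b.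
Proof.
apply/polyP => i; rewrite coefB !coef_exp_poly /exp_coef iterB rmorphB.
by rewrite mulrBr mulrBl.
Qed.

Lemma exp_poly_ker a : kernel a -> exp_poly a = (f a)%:P.
Proof.
move=> Da; apply/polyP => -[|i]; rewrite coef_exp_poly coefC /exp_coef /=.
  by rewrite expr0 mul1r divr1.
have /= -> : iter i.+1 D a = 0 by rewrite iterSr Da; elim: i => //= i ->; exact: raddf0.
by rewrite rmorph0 mulr0 mul0r.
Qed.

Lemma exp_poly0 : exp_poly 0 = 0.
Proof. by rewrite -(subrr 0) exp_polyB subrr. Qed.

Lemma exp_polyD a b : exp_poly (a + b) = exp_poly a + exp_poly b.
Proof. by rewrite -[b in LHS]opprK exp_polyB -[- b]sub0r exp_polyB exp_poly0 sub0r opprK. Qed.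

Hypothesis f_inj : injective f.

Lemma exp_char0 n : n.+1%:R != 0 :> L.
Proof. by rewrite -(rmorph_nat f) -(rmorph0 f) (inj_eq f_inj). Qed.

Lemma deriv_exp_poly b : (exp_poly b)^`() = c *: exp_poly (D b).
Proof.
apply/polyP => i; rewrite coef_deriv coefZ !coef_exp_poly /exp_coef -iterSr.
rewrite -[LHS]mulr_natr exprS factS natrM invfM.
have nz : i.+1%:R != 0 :> L := exp_char0 i.
by rewrite -[RHS]mul1r -[X in _ = X * _](mulVf nz); ring_eq.
Qed.

(** Leibniz' rule, coefficient by coefficient, since the derivative
    of [exp_poly b] is [exp_poly (D b)] up to the factor [c]. *)
Lemma exp_polyM a b : exp_poly (a * b) = exp_poly a * exp_poly b.
Proof.
apply/polyP => i; elim: i a b => [|i IH] a b.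
  by rewrite coef0M !coef_exp_poly /exp_coef /= rmorphM expr0 !mul1r !divr1.
apply: (mulIf (exp_char0 i)); rewrite !mulr_natr -!coef_deriv derivM !deriv_exp_poly.
rewrite DM exp_polyD -scalerAl -scalerAr -scalerDr !coefZ.
by rewrite !coefD !IH.
Qed.

Lemma exp_polyX a n : exp_poly (a ^+ n) = exp_poly a ^+ n.
Proof.
elim: n => [|n IH]; last by rewrite !exprS exp_polyM IH.
by rewrite !expr0 exp_poly_ker ?rmorph1 //; exact: derivation1.
Qed.

Lemma exp_poly_horner (q : {poly B}) b :
  exp_poly q.[b] = \sum_(i < size q) exp_poly q`_i * exp_poly b ^+ i.
Proof.
rewrite horner_coef (big_morph exp_poly exp_polyD exp_poly0).
by apply: eq_bigr => i _; rewrite exp_polyM exp_polyX.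
Qed.

End Exponential.
End Derivations.

(** * Height one primes avoid one of two kernels *)

Lemma total_seq_min (T : eqType) (r : T -> T -> Prop) (s : seq T) :
  (forall x y z, x \in s -> y \in s -> z \in s -> r x y -> r y z -> r x z) ->
  (forall x y, x \in s -> y \in s -> r x y \/ r y x) ->
  s != [::] -> exists2 x, x \in s & forall y, y \in s -> r x y.
Proof.
elim: s => // a s IH tr tot _; have [->|s0] := eqVneq s [::].
  exists a; rewrite ?inE // => y; rewrite inE => /eqP->.
  by case: (tot a a); rewrite ?inE ?eqxx.
have inS x : x \in s -> x \in a :: s by rewrite inE orbC => ->.
have [|||x xs xmin] := IH; rewrite ?s0 //.
- by move=> x y z xs ys zs; apply: tr; exact: inS.
- by move=> x y xs ys; apply: tot; exact: inS.
have aS : a \in a :: s by rewrite inE eqxx.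
case: (tot a x aS (inS _ xs)) => rax.
  exists a => // y; rewrite inE => /orP[/eqP->|ys]; first by case: (tot a a).
  exact: (tr a x y aS (inS _ xs) (inS _ ys) rax (xmin y ys)).
exists x; first exact: inS.
by move=> y; rewrite inE => /orP[/eqP->//|]; exact: xmin.
Qed.

Section Images.
Variables (R R' : comNzRingType) (g : {rmorphism R -> R'}).

Lemma image_subring S : subring S -> subring (g @` S).
Proof.
move=> HS; split; first by exists 1; rewrite ?rmorph1 //; exact: subring1.
- by move=> _ _ [x Sx <-] [y Sy <-]; exists (x - y); rewrite ?rmorphB //; exact: subringB.
- by move=> _ _ [x Sx <-] [y Sy <-]; exists (x * y); rewrite ?rmorphM //; exact: subringM.
Qed.

Lemma image_prime S P : injective g -> is_prime S P -> is_prime (g @` S) (g @` P).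
Proof.
move=> gI [[P0 PD PM] PS nP1 Pprime]; split.
- split; first by exists 0; rewrite ?rmorph0.
    by move=> _ _ [x Sx <-] [y Sy <-]; exists (x + y); rewrite ?rmorphD //; exact: PD.
  by move=> _ _ [x Sx <-] [y Sy <-]; exists (x * y); rewrite ?rmorphM //; exact: PM.
- by move=> _ [x Px <-]; exists x => //; exact: PS.
- by move=> [x Px]; rewrite -(rmorph1 g) => /gI E; apply: nP1; rewrite -E.
move=> _ _ [x Sx <-] [y Sy <-] [z Pz]; rewrite -rmorphM => /gI E.
by case: (Pprime x y Sx Sy); rewrite -?E // => H; [left; exists x|right; exists y].
Qed.

End Images.

Lemma tofrac_inj (B : idomainType) : injective (@tofrac B).
Proof. by move=> x y /eqP; rewrite tofrac_eq => /eqP. Qed.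

Lemma extend_valuation_ring (K L : fieldType) (h : {rmorphism K -> L}) (O : set K) :
  valuation_ring O -> exists O', [/\ valuation_ring O', forall x, O x -> O' (h x)
    & forall x, O x -> (max_ideal O' (h x) <-> max_ideal O x)].
Proof.
move=> vO; have hI : injective h := fmorph_inj h.
have := chevalley (image_subring h (proj1 vO)) (image_prime hI (max_ideal_prime vO)).
move=> [O' [vO' OO' MO']]; exists O'; split=> // [x Ox|x Ox]; first by apply: OO'; exists x.
split=> [/MO'|Mx]; last by apply/MO'; exists x.
by case; [exists x|move=> z Mz /hI <-].
Qed.

Lemma center_valuation_ring (B : idomainType) (p : set B) :
  is_prime setT p -> exists O : set {fraction B},
    [/\ valuation_ring O, forall b, O (tofrac b)
      & forall b, max_ideal O (tofrac b) <-> p b].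
Proof.
move=> pP; have := chevalley (image_subring (@tofrac B) (@setT_subring B))
  (image_prime (@tofrac_inj B) pP).
move=> [O [vO BO MO]]; exists O; split=> // b; first by apply: BO; exists b.
split=> [/MO|pb]; last by apply/MO; [exists b|exists b].
by case; [exists b|move=> z pz /tofrac_inj <-].
Qed.

(** Transitivity of the comparison of slopes [v(y_i)/i], written multiplicatively. *)
Lemma slope_trans (K : fieldType) (u v w : K) i j l : v != 0 ->
  (w ^+ i / u ^+ l) ^+ j = (w ^+ j / v ^+ l) ^+ i * (v ^+ i / u ^+ j) ^+ l.
Proof.
move=> v0; rewrite !expr_div_n -!exprM [(j * i)%N]mulnC [(j * l)%N]mulnC [(i * l)%N]mulnC.
by rewrite mulrA divfK // expf_neq0.
Qed.

Section KernelsSeparate.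
Variables (B : idomainType).
Hypothesis char0 : forall n, n.+1%:R != 0 :> B.

(** Let [v] be a valuation centered at [p] and [y_i = D^i(y)/i!]. If [j] minimizes
    [v(y_j)/j] among the [j >= 1], then a [j]-th root [c] of [1/y_j] satisfies
    [v(c^i y_i) >= 0] for all [i >= 1], with equality for [i = j], whereas
    [v(y_0) > 0]: the Gauss valuation of [exp (c T D) y] is zero although its
    constant term has positive valuation. *)
Lemma slope_valuation_ring (D : {additive B -> B}) (D_LND : LND B D) p y :
  is_prime setT p -> p y -> D y != 0 ->
  exists (L : fieldType) (f : {rmorphism B -> L}) (c : L) (O : set L),
    [/\ valuation_ring O, injective f, forall b, O (f b) /\ (max_ideal O (f b) <-> p b),
        coefs_in O (exp_poly D_LND f c y)
      & ~ coefs_in (max_ideal O) (exp_poly D_LND f c y)].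
Proof.
move=> pP py Dy; have [O1 [vO1 BO1 MO1]] := center_valuation_ring pP.
have HO1 := proj1 vO1.
pose yc i : {fraction B} := tofrac (iter i D y) / i`!%:R.
pose N := nilpotency_index D_LND y.
(* the range of [i]: beyond the index of nilpotency all [y_i] vanish *)
pose s := [seq i <- iota 0 N | (0 < i)%N && (yc i != 0)].
have fz n : n`!%:R != 0 :> {fraction B}.
  rewrite -(rmorph_nat (@tofrac B)) tofrac_eq0; exact: fact_char0.
have DN i : (N <= i)%N -> iter i D y = 0.
  rewrite /N /nilpotency_index; case: (cid _) => n /= E le.
  by rewrite -(subnK le) iterD E; elim: (i - n)%N => //= k ->; exact: raddf0.
have s1 : 1%N \in s.
  rewrite mem_filter mem_iota /yc /= divr1 tofrac_eq0 Dy /= add0n ltnNge.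
  by apply: contra Dy => /DN /= ->.
have [|||j js jmin] := @total_seq_min nat (fun i j => O1 (yc j ^+ i / yc i ^+ j)) s.
- move=> i j l; rewrite !mem_filter => /andP[/andP[i0 yi] _] /andP[/andP[j0 yj] _].
  move=> /andP[/andP[l0 yl] _] Oij Ojl; apply: (valuation_ring_root vO1 j0).
  have -> : (yc l ^+ i / yc i ^+ l) ^+ j =
      (yc l ^+ j / yc j ^+ l) ^+ i * (yc j ^+ i / yc i ^+ j) ^+ l.
    exact: slope_trans.
  by apply: (subringM HO1); exact: (subringX HO1).
- by move=> i j _ _; case: (proj2 vO1 (yc j ^+ i / yc i ^+ j)) => [|]; [left|rewrite invf_div; right].
- by case: (s) s1.
move: js; rewrite mem_filter => /andP[/andP[j0 yj] _].
have [L [h [c Ec]]] := adjoin_nth_root (yc j)^-1 j0.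
have [O [vO OO MO]] := extend_valuation_ring h vO1.
pose f : {rmorphism B -> L} := h \o @tofrac B.
have Efc i : exp_coef D f c y i = c ^+ i * h (yc i).
  by rewrite /exp_coef /yc rmorphM fmorphV rmorph_nat mulrA.
exists L, f, c, O; split=> //.
- by move=> u v E; apply: tofrac_inj; exact: (fmorph_inj h E).
- move=> b; split; first exact: (OO _ (BO1 b)).
  by split=> [H|pb]; [exact/MO1/(MO _ (BO1 b)).1|exact/(MO _ (BO1 b)).2/MO1].
- move=> [|i]; rewrite coef_exp_poly Efc; first by rewrite mul1r /yc divr1; exact/OO/BO1.
  have [E0|ne0] := eqVneq (yc i.+1) 0; first by rewrite E0 rmorph0 mulr0; exact: subring0 (proj1 vO).
  apply: (valuation_ring_root vO j0); rewrite exprMn -exprM mulnC exprM Ec -rmorphXn -rmorphXn -rmorphM.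
  rewrite exprVn mulrC; apply/OO/jmin; rewrite mem_filter mem_iota ne0 /= add0n ltnNge.
  by apply: contra ne0 => /DN E; rewrite /yc E rmorph0 mul0r.
move=> /(_ j); rewrite coef_exp_poly Efc Ec -rmorphM mulVf // rmorph1.
by case: (max_ideal_prime vO).
Qed.

Variables (D E : {additive B -> B}) (D_LND : LND B D) (E_LND : LND B E).
Variable k0 : set B.
Hypothesis k0_unit : forall u, k0 u -> u != 0 -> exists v, u * v = 1.
Hypothesis D_k0 : k0 `<=` kernel D.

Section Place.
Variables (p : set B) (x y : B).
Hypothesis p_prime : is_prime setT p.
Hypotheses (px : p x) (py : p y) (Dx : kernel D x) (Ey : kernel E y).
Hypotheses (Ex : E x != 0) (Dy : D y != 0).
Hypothesis kernel_alg : forall a, kernel E a -> algebraic_over (adjoin k0 y) a.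

Variables (L : fieldType) (f : {rmorphism B -> L}) (c : L) (O : set L).
Hypotheses (vO : valuation_ring O) (f_inj : injective f).
Hypothesis Of : forall b, O (f b) /\ (max_ideal O (f b) <-> p b).
Let Phi := exp_poly D_LND f c.
Let OP := coefs_in O.
Let MP := coefs_in (max_ideal O).
Hypotheses (Oy : OP (Phi y)) (nMy : ~ MP (Phi y)).

Let HO : subring O := proj1 vO.
Let HOP : subring OP. Proof. exact: coefs_in_subring. Qed.
Let HMP : is_prime OP MP. Proof. exact/coefs_in_prime/max_ideal_prime. Qed.
Let MPI : is_ideal OP MP. Proof. by case: HMP. Qed.

Let PhiB a b : Phi (a - b) = Phi a - Phi b. Proof. exact: exp_polyB. Qed.
Let PhiM a b : Phi (a * b) = Phi a * Phi b. Proof. exact: exp_polyM. Qed.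
Let PhiX a n : Phi (a ^+ n) = Phi a ^+ n. Proof. exact: exp_polyX. Qed.
Let Phi_ker a : kernel D a -> Phi a = (f a)%:P. Proof. exact: exp_poly_ker. Qed.
Let Phi_coef0 b : (Phi b)`_0 = f b.
Proof. by rewrite coef_exp_poly /exp_coef expr0 mul1r divr1. Qed.

Let in_place : set B := [set b | OP (Phi b)].

Let in_place_subring : subring in_place.
Proof.
split; rewrite /in_place /=.
- by rewrite Phi_ker ?rmorph1; [exact: (subring1 HOP)|exact: derivation1].
- by move=> a b Oa Ob; rewrite PhiB; exact: (subringB HOP).
- by move=> a b Oa Ob; rewrite PhiM; exact: (subringM HOP).
Qed.

Let in_place_ker b : kernel D b -> in_place b.
Proof.
move=> Db; rewrite /in_place /= Phi_ker //; apply: coefs_inC; first exact: subring0.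
exact: (Of b).1.
Qed.

Let MPX a n : OP a -> ~ MP a -> ~ MP (a ^+ n).
Proof.
move=> Oa nMa; have [_ _ nM1 Mprime] := HMP; elim: n => // n IH.
by rewrite exprS => /Mprime[] //; exact: (subringX HOP).
Qed.

Let in_place_integral (q : {poly B}) b : (forall i, in_place q`_i) ->
  (1 < size q)%N -> ~ MP (Phi (lead_coef q)) -> q.[b] = 0 -> in_place b.
Proof.
rewrite lead_coefE; case sq: (size q) => [|[|n]] //= Oq _ nMl qb.
apply: (@gauss_integral _ _ vO (Phi q`_n.+1) _ n (fun i => - Phi q`_i)) => //.
- exact: Oq.
- by move=> i; apply: (subringN HOP); exact: Oq.
have := exp_poly_horner D_LND char0 c f_inj q b; rewrite qb sq exp_poly0 big_ord_recr /=.
move=> /esym/eqP; rewrite addrC addr_eq0 => /eqP ->; rewrite -sumrN.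
by apply: eq_bigr => i _; rewrite mulNr.
Qed.

Let base_in_place : adjoin k0 y `<=` in_place.
Proof. by apply: adjoin_min => // u /D_k0; exact: in_place_ker. Qed.

(** [Phi y] has Gauss valuation zero and a constant term of positive valuation.
    Dividing by a power of [y], one may assume that [r] has a nonzero constant
    coefficient over [k0]; it is a unit and prevails in the constant term of
    [Phi r]. *)
Let base_unit r : adjoin k0 y r -> r != 0 -> ~ MP (Phi r).
Proof.
move=> [q]; elim/poly_ind: q r => [|w u IH] r kq ->; first by rewrite horner0 eqxx.
have Ew i : (w * 'X + u%:P)`_i.+1 = w`_i by rewrite coefD coefMX coefC addr0.
have ku : k0 u by have := kq 0%N; rewrite coefD coefMX coefC add0r.
have kw : coefs_in k0 w by move=> i; rewrite -Ew; exact: kq.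
have [nM1 Mprime] : ~ MP 1 /\ forall a b, OP a -> OP b -> MP (a * b) -> MP a \/ MP b.
  by case: HMP.
have Ow : in_place w.[y] by apply: base_in_place; exists w.
rewrite hornerD hornerM hornerX hornerC; have [->|u0] := eqVneq u 0.
  rewrite addr0 mulf_eq0 negb_or => /andP[w0 _]; rewrite PhiM => /Mprime[] //.
  exact: IH.
move=> _ /(_ 0%N); rewrite Phi_coef0 => /(Of _).2 pwu.
have [[p0 pD pM] _ np1 _] := p_prime; have [v uv] := k0_unit ku u0.
apply: np1; rewrite -uv mulrC; apply: (pM) => //.
have -> : u = (w.[y] * y + u) + (- w.[y]) * y by ring_eq.
by apply: (pD) => //; apply: pM.
Qed.

(** [a] and its inverse are algebraic over [k0[y]], on which the valuation is zero. *)
Let kernel_unit a : kernel E a -> a != 0 -> in_place a /\ ~ MP (Phi a).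
Proof.
move=> Ea a0; have [q [kq q0 qa]] := algebraic_over_coef0 a0 (kernel_alg Ea).
have Oq i : in_place q`_i by apply: base_in_place; exact: kq.
have nq : q != 0 by apply: contraNneq q0 => ->; rewrite coef0.
have sq : (1 < size q)%N.
  rewrite ltnNge; apply: contra q0 => /size1_polyC E1.
  by move: qa; rewrite E1 hornerC coefC => ->.
have Oa : in_place a.
  by apply: (in_place_integral Oq sq _ qa); apply: base_unit; rewrite ?lead_coef_eq0 //; exact: kq.
split=> // Ma; apply: (base_unit (kq 0%N) q0).
have := exp_poly_horner D_LND char0 c f_inj q a; rewrite qa exp_poly0.
case: (size q) sq => // n _; rewrite big_ord_recl expr0 mulr1 => /esym/eqP.
rewrite addr_eq0 => /eqP E0; have -> : Phi q`_0 = _ := E0.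
apply: (is_idealN HOP MPI); apply: (is_ideal_sum MPI) => i.
have [_ _ MM] := MPI; rewrite exprSr mulrA; apply: (MM) => //.
apply: (subringM HOP); first exact: Oq.
by apply: (subringX HOP).
Qed.

(** Over the fraction field of [kernel E], on which the valuation is zero, [B] is a ring
    of polynomials in a slice [t], and [t] is integral over [x] because [x] is a
    nonconstant polynomial in [t]. As [x] belongs to the place, so does [B]. *)
Let all_in_place b : in_place b.
Proof.
have [t [Et Kt]] := local_slice E_LND Ex.
have HK := kernel_subring E_LND.
have expand z : exists e q, [/\ kernel E e, e != 0, coefs_in (kernel E) q & e * z = q.[t]].
  have [m [M [q [Kq Eq]]]] := slice_expansion E_LND z Kt.
  exists (m.+1%:R * E t ^+ M), q; split=> //; last by rewrite mulf_neq0 // expf_neq0.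
  by apply: (subringM HK); [exact: (subring_nat HK)|exact: (subringX HK)].
have ker_place a : kernel E a -> in_place a.
  move=> Ea; have [->|a0] := eqVneq a 0; first exact: subring0.
  by case: (kernel_unit Ea a0).
have Ot : in_place t.
  have [e [q [Ke e0 Kq Eq]]] := expand x.
  have sq : (1 < size q)%N.
    rewrite ltnNge; apply/negP => /size1_polyC E1; move: Eq; rewrite E1 hornerC => Eq.
    have := Kq 0%N; rewrite -Eq /kernel /= derivation_kerM // => /eqP.
    by rewrite mulf_eq0 (negbTE e0) (negbTE Ex).
  have sC : (size (- (e * x)%:P) < size q)%N.
    by rewrite size_polyN (leq_ltn_trans (size_polyC_leq1 _)).
  apply: (@in_place_integral (q - (e * x)%:P)).
  - move=> i; rewrite coefB; apply: (subringB in_place_subring); first exact/ker_place/Kq.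
    rewrite coefC; case: (i == 0)%N; last exact: subring0.
    apply: (subringM in_place_subring); first exact: ker_place.
    exact: in_place_ker.
  - by rewrite size_polyDl.
  - rewrite lead_coefDl //; apply: (kernel_unit _ _).2; first exact: Kq.
    by rewrite lead_coef_eq0 -size_poly_gt0 ltnW.
  - by rewrite hornerD hornerN hornerC Eq subrr.
have [e [q [Ke e0 Kq Eq]]] := expand b.
have sC : (size (- q.[t]%:P) < size (e *: 'X))%N.
  by rewrite size_polyN size_scale // size_polyX (leq_ltn_trans (size_polyC_leq1 _)).
apply: (@in_place_integral (e *: 'X - q.[t]%:P)).
- move=> i; rewrite coefB; apply: (subringB in_place_subring).
    rewrite coefZ coefX; apply: (subringM in_place_subring); first exact: ker_place.
    exact: (subring_nat in_place_subring).
  rewrite coefC; case: (i == 0)%N; last exact: subring0.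
  by apply: (subring_horner in_place_subring) => // j; exact/ker_place/Kq.
- by rewrite size_polyDl // size_scale // size_polyX.
- rewrite lead_coefDl // lead_coefZ lead_coefX mulr1.
  by case: (kernel_unit Ke e0).
- by rewrite hornerD hornerN hornerC hornerZ hornerX Eq subrr.
Qed.

(** The left side would have valuation zero if [d] were not in [p], whereas [x] has
    positive valuation and [b] nonnegative valuation. *)
Lemma place_absurd d n b : d * y ^+ n = x * b -> p d.
Proof.
move=> Edb; apply/(Of d).2; rewrite -Phi_coef0.
have [_ _ nM1 Mprime] := HMP; have [_ _ MM] := MPI.
have Md : MP (Phi d * Phi y ^+ n).
  rewrite -PhiX -PhiM Edb PhiM mulrC; apply: (MM); first exact: all_in_place.
  rewrite Phi_ker //; apply: coefs_inC; first by left.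
  exact/(Of x).2.
case: (Mprime _ _ (all_in_place d) (subringX HOP n Oy) Md) => [H|H]; first exact: H.
by case: (MPX Oy nMy H).
Qed.

End Place.

Lemma kernels_separate p x y d n b : is_prime setT p -> p x -> p y ->
  kernel D x -> kernel E y -> E x != 0 -> D y != 0 ->
  (forall a, kernel E a -> algebraic_over (adjoin k0 y) a) ->
  d * y ^+ n = x * b -> p d.
Proof.
move=> pP px py Dx Ey Ex Dy kalg Edb.
have [L [f [c [O [vO fI Of Oy nMy]]]]] := slope_valuation_ring D_LND pP py Dy.
exact: (place_absurd pP px py Dx Ex kalg vO fI Of Oy nMy Edb).
Qed.

End KernelsSeparate.

(** * Transcendence degree and chains of primes *)

Section IdealStructures.
Variable R : comNzRingType.

Lemma ideal_of_set (J : set R) : is_ideal setT J -> ~ J 1 ->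
  exists I : idealr R, forall x, x \in I <-> J x.
Proof.
move=> [J0 JD JM] nJ1.
pose S (x : R) := `[< J x >].
have SI : idealr_closed (S : {pred R}).
  split; [exact/asboolP| |].
    by apply/negP => /asboolP.
  move=> a x y /asboolP Jx /asboolP Jy; apply/asboolP; apply: (JD) => //; exact: JM.
pose c := isIdealr.Build R S SI.
pose I : idealr R := HB.pack S c.
by exists I => x; split=> /asboolP.
Qed.

Lemma Spec_of_set (J : set R) : is_prime setT J ->
  exists P : Spec R, forall x, x \in P <-> J x.
Proof.
move=> [[J0 JD JM] _ nJ1 Jprime].
pose S (x : R) := `[< J x >].
have SI : idealr_closed (S : {pred R}).
  split; [exact/asboolP| |].
    by apply/negP => /asboolP.
  move=> a x y /asboolP Jx /asboolP Jy; apply/asboolP; apply: (JD) => //; exact: JM.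
have SP : prime_idealr_closed (S : {pred R}).
  by move=> x y /asboolP/(Jprime _ _ I I)[] H; apply/orP; [left|right]; apply/asboolP.
pose c := isIdealr.Build R S SI.
pose d := isPrimeIdealrClosed.Build R S SP.
pose P : Spec R := HB.pack S c d.
by exists P => x; split=> /asboolP.
Qed.

Lemma ideal_set (I : idealr R) : is_ideal setT [set x | x \in I].
Proof.
split=> /=; [exact: idealr0|by move=> x y; exact: rpredD|by move=> a x _; exact: idealMr].
Qed.

Lemma Spec_prime (P : Spec R) : is_prime setT [set x | x \in P].
Proof.
split=> //; first exact: ideal_set.
  by rewrite /= idealr1.
by move=> x y _ _ /=; rewrite prime_idealrM => /orP.
Qed.

End IdealStructures.

(** Inverses of units are obtained by choice. *)
Lemma integral_embedding (Q : comNzRingType) :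
  (forall x y : Q, x * y = 0 -> (x == 0) || (y == 0)) ->
  exists (D : idomainType) (f : {rmorphism Q -> D}), injective f.
Proof.
move=> integral.
pose U (x : Q) : bool := `[< exists y, y * x = 1 >].
pose V (x : Q) : Q := if pselect (exists y, y * x = 1) is left H then sval (cid H) else x.
have VU : {in U, left_inverse 1 V *%R}.
  by move=> x /asboolP H; rewrite /V; case: pselect => // H'; exact: svalP (cid H').
have UP (x y : Q) : y * x = 1 -> U x by move=> E; apply/asboolP; exists y.
have VO : {in [predC U], V =1 id}.
  move=> x /asboolPn H; rewrite /V; case: pselect => // H'; by case: H.
pose c := GRing.ComNzRing_hasMulInverse.Build Q VU UP VO.
pose QU : comUnitRingType := HB.pack (GRing.ComNzRing.sort Q) c.
pose d := GRing.ComUnitRing_isIntegral.Build QU integral.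
pose D : idomainType := HB.pack (GRing.ComNzRing.sort Q) c d.
by exists D, (idfun : {rmorphism Q -> Q}) => x y.
Qed.

Lemma residue_field (B : comNzRingType) (P : set B) : is_prime setT P ->
  exists (K : fieldType) (f : {rmorphism B -> K}), forall b, f b = 0 <-> P b.
Proof.
move=> /Spec_of_set[p pP].
have [D [g gI]] := integral_embedding (@Quotient.rquot_IdomainAxiom _ p).
exists {fraction D}, (@tofrac D \o (g \o \pi_({ideal_quot p})%qT)) => b; rewrite -pP /=.
have -> : (b \in p) = (\pi_({ideal_quot p})%qT b == 0).
  by rewrite -[b in LHS]subr0 Quotient.idealrBE -[0 in RHS](rmorph0 (\pi_({ideal_quot p})%qT)).
rewrite -(inj_eq gI) rmorph0 -tofrac_eq0; by split=> [->|/eqP].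
Qed.

Section Transcendence.
Variable R : comNzRingType.

Definition transcendental (P S : set R) z :=
  forall q, coefs_in S q -> P q.[z] -> coefs_in P q.

Lemma transcendental0 (S : set R) z :
  transcendental [set 0] S z <-> ~ algebraic_over S z.
Proof.
split=> [tz [q [Sq q0 qz]]|nz q Sq qz].
  by move/eqP: q0; apply; apply/polyP => i; rewrite coef0; exact: tz.
suff -> : q = 0 by move=> i; rewrite /= coef0.
by apply: contrapT => /eqP q0; apply: nz; exists q.
Qed.

Lemma transcendental_eq0 (S : set R) z q :
  transcendental [set 0] S z -> coefs_in S q -> q.[z] = 0 -> q = 0.
Proof. by move=> tz Sq /(tz q Sq) q0; apply/polyP => i; rewrite coef0; exact: q0. Qed.

End Transcendence.

Section Specialization.
Variable K : fieldType.
Implicit Types (S : set K) (z : K).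

(** A relation for [z] over [S[b]] is a polynomial in two variables; read it as
    a relation for [b] over [S[z]]. *)
Lemma algebraic_exchange S z b : transcendental [set 0] S z ->
  ~ transcendental [set 0] (adjoin S b) z -> algebraic_over (adjoin S z) b.
Proof.
move=> tz /transcendental0/contrapT[q [Sq q0 qz]].
have /choice[u Hu] : forall i, exists v, coefs_in S v /\ q`_i = v.[b].
  by move=> i; case: (Sq i) => v; exists v.
pose W := \sum_(i < size q) z ^+ i *: u i.
have EW j : W`_j = (\sum_(i < size q) (u i)`_j *: 'X^i).[z].
  rewrite coef_sum horner_sum; apply: eq_bigr => i _.
  by rewrite coefZ hornerZ hornerXn mulrC.
have Eu j k : (\sum_(i < size q) (u i)`_j *: 'X^i)`_k =
    if (k < size q)%N then (u k)`_j else 0.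
  rewrite coef_sum; under eq_bigr do rewrite coefZ coefXn.
  case: ltnP => lt.
    rewrite (bigD1 (Ordinal lt)) //= eqxx mulr1 big1 ?addr0 // => i ne.
    rewrite (_ : (k == i) = false) ?mulr0 //; apply: contraNF ne => /eqP E.
    exact/eqP/val_inj.
  rewrite big1 // => i _; rewrite gtn_eqF ?mulr0 //.
  exact: leq_trans (ltn_ord i) lt.
have S0 : S 0 by have := (Hu (size q)).1 (size (u (size q))); rewrite nth_default.
have cu j : coefs_in S (\sum_(i < size q) (u i)`_j *: 'X^i).
  by move=> k; rewrite Eu; case: ifP => // _; exact: (Hu k).1.
exists W; split.
- by move=> j; exists (\sum_(i < size q) (u i)`_j *: 'X^i).
- apply: contraNneq q0 => W0; rewrite -lead_coef_eq0 lead_coefE.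
  case sq: (size q) => [|n]; first by rewrite nth_default // sq.
  rewrite /= (Hu n).2 (_ : u n = 0) ?horner0 //; apply/polyP => j; rewrite coef0.
  have /transcendental_eq0 : (\sum_(i < size q) (u i)`_j *: 'X^i).[z] = 0.
    by rewrite -EW W0 coef0.
  move=> /(_ S tz (cu j)) E; have := Eu j n; rewrite E coef0 sq ltnSn.
  exact: esym.
rewrite /W horner_sum -[RHS]qz [in RHS]horner_coef; apply: eq_bigr => i _.
by rewrite hornerZ (Hu i).2 mulrC.
Qed.

(** Adjoin the elements of [l] one at a time, as long as [z] stays transcendental;
    by exchange the rejected ones are algebraic once [z] is added. *)
Lemma transcendental_split S z (l : seq K) : subring S ->
  transcendental [set 0] S z ->
  exists S', [/\ subring S', S `<=` S', transcendental [set 0] S' z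
    & forall b, b \in l -> algebraic_over (adjoin S' z) b].
Proof.
elim: l S => [|b l IH] S HS tz; first by exists S; split.
case: (pselect (transcendental [set 0] (adjoin S b) z)) => [tb|nb].
  have [S' [HS' SS' tz' al]] := IH _ (adjoin_subring b HS) tb.
  exists S'; split=> //; first by move=> x Sx; apply: SS'; exact: adjoin_sub.
  move=> d; rewrite inE => /orP[/eqP->|/al//]; exists ('X - b%:P); split.
  - apply: (subringB (coefs_in_subring (adjoin_subring z HS'))).
      exact: coefs_inX (adjoin_subring z HS').
    apply: coefs_inC; first exact: subring0 (adjoin_subring z HS').
    by apply: adjoin_sub => //; apply: SS'; exact: adjoin_gen.
  - by rewrite polyXsubC_eq0.
  - by rewrite hornerXsubC subrr.
have [S' [HS' SS' tz' al]] := IH S HS tz.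
exists S'; split=> // d; rewrite inE => /orP[/eqP->|/al//].
apply: (algebraic_over_sub _ (algebraic_exchange tz nb)).
apply: adjoin_min; first exact: adjoin_subring.
  by move=> x /SS'; exact: adjoin_sub.
exact: adjoin_gen.
Qed.

Lemma nat_nonroot (q : {poly K}) : (forall n, n.+1%:R != 0 :> K) -> q != 0 ->
  exists n : nat, q.[n%:R] != 0.
Proof.
move=> char0 q0; apply: contrapT => no.
have rt n : root q n%:R by apply/negPn/negP => H; apply: no; exists n.
have natI : injective (fun n : nat => n%:R : K).
  move=> m n; wlog le : m n / (m <= n)%N.
    by move=> W; case: (leqP m n) => [/W//|/ltnW/W H /esym/H].
  move/eqP; rewrite eq_sym -subr_eq0 -natrB //.
  case: (n - m)%N (subnKC le) => [|d _]; first by rewrite addn0.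
  by rewrite (negbTE (char0 d)).
have := @max_poly_roots _ q [seq n%:R | n <- iota 0 (size q)] q0.
rewrite size_map size_iota ltnn map_inj_uniq ?iota_uniq //.
by move=> /(_ _ isT) H; have : false by apply: H; apply/allP => _ /mapP[n _ ->].
Qed.

(** Extend the specialization of [z] to an integer [n] at which the leading coefficients
    of algebraic relations for the elements of [l] do not vanish: those elements
    are then integral over the valuation ring. *)
Lemma specialization S z (l : seq K) : (forall n, n.+1%:R != 0 :> K) ->
  subring S -> transcendental [set 0] S z ->
  exists O (n : nat), [/\ valuation_ring O, S `<=` O, forall b, b \in l -> O b,
    max_ideal O (z - n%:R) & forall r, S r -> max_ideal O r -> r = 0].
Proof.
move=> char0 HS0 tz0; have [S' [HS SS' tz al]] := transcendental_split l HS0 tz0.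
have /choice[G HG] : forall b, exists G, coefs_in S' G /\ (b \in l ->
    exists q, [/\ coefs_in (adjoin S' z) q, q != 0, q.[b] = 0, G != 0 & lead_coef q = G.[z]]).
  move=> b; case: (boolP (b \in l)) => [/al[q [Sq q0 qb]]|_]; last first.
    by exists 0; split=> // i; rewrite coef0; exact: subring0.
  have [G SG EG] := Sq (size q).-1; exists G; split=> // _; exists q; split=> //.
  by move: q0; apply: contraNneq => G0; rewrite -lead_coef_eq0 lead_coefE EG G0 horner0.
have [|n nz] := @nat_nonroot (\prod_(b <- l) G b) char0.
  rewrite prodf_seq_neq0; apply/allP => b bl; apply/implyP => _.
  by case: ((HG b).2 bl) => q [].
pose c : K := n%:R; have Sc : S' c by exact: subring_nat.
have inj u v : coefs_in S' u -> coefs_in S' v -> u.[z] = v.[z] -> u = v.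
  move=> Su Sv E; apply/eqP; rewrite -subr_eq0; apply/eqP; apply: (transcendental_eq0 tz).
    exact: (subringB (coefs_in_subring HS)).
  by rewrite hornerD hornerN E subrr.
pose Pc x := exists u, [/\ coefs_in S' u, u.[c] = 0 & x = u.[z]].
have HP := coefs_in_subring HS.
have PcP : is_prime (adjoin S' z) Pc.
  split.
  - split; first by exists 0; split; rewrite ?horner0 //; exact: (subring0 HP).
      move=> _ _ [u [Su uc ->]] [v [Sv vc ->]]; exists (u + v).
      by split; rewrite ?hornerD ?uc ?vc ?addr0 //; exact: (subringD HP).
    move=> _ _ [u Su ->] [v [Sv vc ->]]; exists (u * v).
    by split; rewrite ?hornerM ?vc ?mulr0 //; exact: (subringM HP).
  - by move=> _ [u [Su _ ->]]; exists u.
  - move=> [u [Su uc E]]; have E1 : u = 1.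
      by apply: inj => //; [exact: (subring1 HP)|rewrite -E hornerC].
    by move/eqP: uc; rewrite E1 hornerC oner_eq0.
  - move=> _ _ [u Su ->] [v Sv ->] [w [Sw wc E]].
    have Ew : w = u * v by apply: inj; rewrite ?hornerM //; exact: (subringM HP).
    move/eqP: wc; rewrite Ew hornerM mulf_eq0 => /orP[]/eqP E0; [left|right].
      by exists u.
    by exists v.
have [O [vO AO MO]] := chevalley (adjoin_subring z HS) PcP.
exists O, n; split=> //.
- by move=> x /SS' Sx; apply: AO; exact: adjoin_sub.
- move=> b bl; have [SG /(_ bl)[q [Sq q0 qb G0 EG]]] := HG b.
  have nM : ~ max_ideal O (lead_coef q).
    rewrite MO; last exact: Sq.
    move=> [u [Su uc]]; rewrite EG => /(inj _ _ SG Su) Eu.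
    move: nz; rewrite horner_prod prodf_seq_neq0 => /allP/(_ b bl).
    by rewrite /= Eu uc eqxx.
  move: nM; rewrite lead_coefE; case sq: (size q) => [|[|m]].
  - by move/eqP: sq; rewrite size_poly_eq0 (negbTE q0).
  - move: qb q0; rewrite (size1_polyC (eq_leq sq)) hornerC => ->.
    by rewrite eqxx.
  move=> nM; apply: (@valuation_ring_integral _ _ vO q`_m.+1 b m (fun i => - q`_i)) => //.
  - exact/AO/Sq.
  - by move=> i; apply: (subringN (proj1 vO)); exact/AO/Sq.
  move/eqP: qb; rewrite horner_coef sq big_ord_recr /= addrC addr_eq0 => /eqP ->.
  by rewrite -sumrN; apply: eq_bigr => i _; rewrite mulNr.
- have SX : coefs_in S' ('X - c%:P).
    apply: (subringB HP); first exact: coefs_inX.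
    by apply: coefs_inC => //; exact: subring0.
  have E : ('X - c%:P).[z] = z - c by rewrite hornerXsubC.
  apply/MO; first by exists ('X - c%:P).
  by exists ('X - c%:P); split; rewrite ?hornerXsubC ?subrr.
- move=> r /SS' Sr /MO[|u [Su uc E]]; first exact: adjoin_sub.
  have Eu : u = r%:P.
    by apply: inj; rewrite ?hornerC //; apply: coefs_inC => //; exact: subring0.
  by move: uc; rewrite Eu hornerC.
Qed.

End Specialization.

Section LiftPrime.
Variables (B : idomainType) (k0 : set B) (gens : seq B).
Hypothesis B_generated : forall S : set B, subring S -> k0 `<=` S ->
  (forall g, g \in gens -> S g) -> forall b, S b.
Hypothesis nat_unit : forall n, exists v : B, n.+1%:R * v = 1.

(** Specialize [z] in the residue field of [P], and take the center of the
    valuation obtained. *)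
Lemma larger_prime P S z : is_prime setT P -> subring S -> k0 `<=` S ->
  transcendental P S z ->
  exists Q, [/\ is_prime setT Q, P `<=` Q, exists2 u, Q u & ~ P u
    & forall r, S r -> Q r -> P r].
Proof.
move=> PP HS kS tz; have [K [f fP]] := residue_field PP.
have char0 n : n.+1%:R != 0 :> K.
  have [v E] := nat_unit n; apply/eqP => E0; have := congr1 f E.
  by rewrite rmorphM rmorph_nat E0 mul0r rmorph1 => /esym/eqP; rewrite oner_eq0.
have tfz : transcendental [set 0] (f @` S) (f z).
  move=> q Sq; have /choice[u Hu] : forall i, exists r, S r /\ f r = q`_i.
    by move=> i; case: (Sq i) => r Sr E; exists r.
  pose q' := \poly_(i < size q) u i.
  have Eq : map_poly f q' = q.
    apply/polyP => i; rewrite coef_map coef_poly; case: ltnP => [lt|le].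
      exact: (Hu i).2.
    by rewrite raddf0 nth_default.
  have Sq' : coefs_in S q'.
    by move=> i; rewrite coef_poly; case: ifP => _; [exact: (Hu i).1|exact: subring0].
  rewrite -{1}Eq horner_map => /= /fP/(tz q' Sq') Pq i.
  by rewrite /= -Eq coef_map; exact/fP.
have [O [n [vO SO lO Mz MS]]] :=
  specialization [seq f g | g <- gens] char0 (image_subring f HS) tfz.
have HO := proj1 vO.
have allO b : O (f b).
  apply: (B_generated (S := [set b | O (f b)])) => /=.
  - split; rewrite /= ?rmorph1; first exact: subring1.
      by move=> x y Ox Oy; rewrite rmorphB; exact: subringB.
    by move=> x y Ox Oy; rewrite rmorphM; exact: subringM.
  - by move=> x /kS Sx; apply: SO; exists x.
  - by move=> g gg; apply: lO; exact: map_f.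
have [[M0 MD MM] _ nM1 Mprime] := max_ideal_prime vO.
exists [set b | max_ideal O (f b)]; split.
- split=> //=; last 2 first.
  + by rewrite rmorph1.
  + by move=> x y _ _; rewrite rmorphM; exact: Mprime.
  split=> /=; first by rewrite rmorph0.
    by move=> x y; rewrite rmorphD; exact: MD.
  by move=> a x _; rewrite rmorphM; exact: MM.
- by move=> x /fP /= ->.
- exists (z - n%:R); first by rewrite /= rmorphB rmorph_nat.
  have SX : coefs_in S ('X - n%:R%:P).
    apply: (subringB (coefs_in_subring HS)); first exact: coefs_inX.
    by apply: coefs_inC; [exact: subring0|exact: subring_nat].
  rewrite -hornerXsubC => /(tz _ SX)/(_ 1%N).
  rewrite coefB coefX coefC subr0; case: PP => _ _ nP1 _; exact: nP1.
- by move=> r Sr /= Mr; apply/fP; apply: MS => //; exists r.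
Qed.

(** Giving up one of the three elements at a time produces a chain of primes
    of length three. *)
Lemma dim2_dependent x y z : krull_dim B 2 -> subring k0 ->
  transcendental [set 0] k0 x -> transcendental [set 0] (adjoin k0 x) y ->
  transcendental [set 0] (adjoin (adjoin k0 x) y) z -> False.
Proof.
move=> [_ dim2] Hk tx ty tz; set k1 := adjoin k0 x in ty tz; set k2 := adjoin k1 y in tz.
have H1 : subring k1 := adjoin_subring x Hk; have H2 : subring k2 := adjoin_subring y H1.
have k01 : k0 `<=` k1 := adjoin_sub x Hk; have k12 : k1 `<=` k2 := adjoin_sub y H1.
have P0 : is_prime [set: B] [set 0].
  split=> //=; last 2 first.
  - by move/eqP; rewrite oner_eq0.
  - by move=> u v _ _ /eqP; rewrite mulf_eq0 => /orP[]/eqP->; [left|right].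
  by split=> //= [u v -> ->|a u _ ->]; rewrite ?addr0 ?mulr0.
have trans (P S : set B) (t : B) : subring S -> (forall r, S r -> P r -> r = 0) ->
    P 0 -> forall T : set B, (forall r, T r -> S r) -> S t -> transcendental [set 0] T t ->
    transcendental P T t.
  move=> HS PS P0' T TS St tt q Tq /PS E i.
  have -> : q = 0; last by rewrite coef0.
  apply: (transcendental_eq0 tt) => //; apply: E.
  by apply: (subring_horner HS) => // j; exact/TS/Tq.
have [P1 [P1P P01 [u1 P1u nP0u] P1S]] := larger_prime P0 H2 (subset_trans k01 k12) tz.
have ty1 : transcendental P1 k1 y.
  apply: (trans P1 k2 y) => //; last exact: adjoin_gen.
  by case: P1P => -[].
have [P2 [P2P P12 [u2 P2u nP1u] P2S]] := larger_prime P1P H1 k01 ty1.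
have tx2 : transcendental P2 k0 x.
  apply: (trans P2 k1 x) => //; last 2 first.
  - by case: P2P => -[].
  - exact: adjoin_gen.
  by move=> r kr P2r; apply: P1S; [exact: k12|exact: P2S].
have [P3 [P3P P23 [u3 P3u nP2u] _]] := larger_prime P2P Hk (fun _ => id) tx2.
have [p0 E0] := Spec_of_set P0; have [p1 E1] := Spec_of_set P1P.
have [p2 E2] := Spec_of_set P2P; have [p3 E3] := Spec_of_set P3P.
pose c i := match i with 0 => p0 | 1 => p1 | 2 => p2 | _ => p3 end.
suff /dim2 : prime_chain 3 c by [].
have step (p q : Spec B) (P Q : set B) u : (forall x, x \in p <-> P x) ->
    (forall x, x \in q <-> Q x) -> P `<=` Q -> Q u -> ~ P u ->
    {subset p <= q} /\ ~ {subset q <= p}.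
  move=> Ep Eq PQ Qu nPu; split; first by move=> v /Ep/PQ/Eq.
  by move=> /(_ u) H; apply/nPu/Ep/H/Eq.
move=> [|[|[|//]]] _.
- exact: step E0 E1 P01 P1u nP0u.
- exact: step E1 E2 P12 P2u nP1u.
- exact: step E2 E3 P23 P3u nP2u.
Qed.

End LiftPrime.

(** * Noetherian rings *)

Definition noeth (R : comNzRingType) := forall J : set R, is_ideal setT J ->
  exists s : seq R, J = span setT [set` s].

Section Noetherian.
Variable R : comNzRingType.
Hypothesis R_noeth : noeth R.
Implicit Types J : set R.

Lemma chain_mono (C : nat -> set R) : (forall n, C n `<=` C n.+1) ->
  forall m n, (m <= n)%N -> C m `<=` C n.
Proof.
move=> inc m n le; rewrite -(subnK le) => x Cx.
by elim: (n - m)%N => //= d; exact: inc.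
Qed.

Lemma noeth_chain (C : nat -> set R) :
  (forall n, is_ideal setT (C n)) -> (forall n, C n `<=` C n.+1) ->
  exists N, forall n, C n `<=` C N.
Proof.
move=> CI inc; have mono := chain_mono inc.
pose U x := exists n, C n x.
have UI : is_ideal setT U.
  split; first by exists 0%N; case: (CI 0%N).
    move=> x y [m Cx] [n Cy]; exists (maxn m n); have [_ CD _] := CI (maxn m n).
    by apply: CD; [apply: mono Cx; exact: leq_maxl|apply: mono Cy; exact: leq_maxr].
  by move=> a x _ [m Cx]; exists m; have [_ _ CM] := CI m; exact: CM.
have [s Es] := R_noeth UI.
have [N HN] : exists N, forall x, x \in s -> C N x.
  have : forall x, x \in s -> U x by move=> x xs; rewrite Es; exact: span_gen.
  elim: (s) => [|a l IH] Hl; first by exists 0%N.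
  have [|N HN] := IH; first by move=> x xl; apply: Hl; rewrite inE xl orbT.
  have [|n Ca] := Hl a; first by rewrite inE eqxx.
  exists (maxn n N) => x; rewrite inE => /orP[/eqP->|/HN Cx].
    exact: (mono n _ (leq_maxl _ _) _ Ca).
  exact: (mono N _ (leq_maxr _ _) _ Cx).
exists N => n x Cx; have : U x by exists n.
by rewrite Es; apply: span_min => // y /= /HN.
Qed.

(** Otherwise dependent choice yields a strictly increasing sequence of ideals. *)
Lemma noeth_maximal (F : set (set R)) : (forall J, F J -> is_ideal setT J) ->
  (exists J, F J) -> exists J, F J /\ forall J', F J' -> J `<=` J' -> J' `<=` J.
Proof.
move=> FI [J0 FJ0]; apply: contrapT => no.
have /choice[next Hnext] : forall J : {J | F J}, exists J' : {J | F J},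
    sval J `<=` sval J' /\ ~ sval J' `<=` sval J.
  move=> [J FJ]; apply: contrapT => nJ; apply: no; exists J; split=> // J' FJ' JJ'.
  by apply: contrapT => nJJ; apply: nJ; exists (exist _ J' FJ').
pose C n := iter n next (exist _ J0 FJ0).
have [N HN] := @noeth_chain (fun n => sval (C n)) (fun n => FI _ (svalP (C n)))
  (fun n => (Hnext (C n)).1).
exact: ((Hnext (C N)).2 (HN N.+1)).
Qed.

Definition add_gen J x : set R := [set z | exists a, J (z - a * x)].

Lemma add_gen_ideal J x : is_ideal setT J ->
  [/\ is_ideal setT (add_gen J x), J `<=` add_gen J x & add_gen J x x].
Proof.
move=> JI; have [J0 JD JM] := JI; split.
- split; first by exists 0; rewrite mul0r subr0.
    move=> u v [a Ja] [b Jb]; exists (a + b).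
    have -> : u + v - (a + b) * x = (u - a * x) + (v - b * x) by ring_eq.
    exact: JD.
  move=> c u _ [a Ja]; exists (c * a).
  have -> : c * u - c * a * x = c * (u - a * x) by ring_eq.
  exact: JM.
- by move=> z Jz; exists 0; rewrite mul0r subr0.
- by exists 1; rewrite mul1r subrr.
Qed.

(** Ideals maximal among those disjoint from a multiplicative set are prime. *)
Lemma prime_avoiding (T J : set R) : T 1 -> (forall x y, T x -> T y -> T (x * y)) ->
  is_ideal setT J -> (forall x, J x -> ~ T x) ->
  exists P, [/\ is_prime setT P, J `<=` P & forall x, P x -> ~ T x].
Proof.
move=> T1 TM JI JT.
pose F : set (set R) := [set I | [/\ is_ideal setT I, J `<=` I & forall x, I x -> ~ T x]].
have [||P [[PI JP PT] Pmax]] := @noeth_maximal F; first by move=> I [].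
  by exists J; split.
exists P; split=> //; split=> //; first by move/PT.
have bigger x : ~ P x -> exists2 t, T t & add_gen P x t.
  move=> nPx; have [AI PA Ax] := add_gen_ideal x PI.
  apply: contrapT => no; apply/nPx/(Pmax (add_gen P x)) => //; split=> //.
    by move=> z /JP /PA.
  by move=> z Az Tz; apply: no; exists z.
move=> x y _ _ Pxy; apply: contrapT => /not_orP[/bigger[s Ts [a Pa]] /bigger[t Tt [b Pb]]].
apply: (PT (s * t)); last exact: TM.
have [_ PD PM] := PI.
have -> : s * t = t * (s - a * x) + a * x * (t - b * y) + a * b * (x * y) by ring_eq.
by apply: (PD); [apply: (PD)|]; exact: PM.
Qed.

(** A maximal counterexample is not prime; if it contains [x * y], then every prime
    above it contains [x] or [y], and the ideals obtained by adding [x] or [y] are not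
    counterexamples. *)
Lemma finite_minimal_primes J : is_ideal setT J ->
  exists (n : nat) (P : nat -> Spec R), (forall i, (i < n)%N -> forall x, J x -> x \in P i) /\
    forall Q : Spec R, (forall x, J x -> x \in Q) ->
      exists2 i, (i < n)%N & {subset P i <= Q}.
Proof.
move=> JI; apply: contrapT => nJ.
pose good I := exists (n : nat) (P : nat -> Spec R),
  (forall i, (i < n)%N -> forall x, I x -> x \in P i) /\
  forall Q : Spec R, (forall x, I x -> x \in Q) -> exists2 i, (i < n)%N & {subset P i <= Q}.
pose F : set (set R) := [set I | is_ideal setT I /\ ~ good I].
have [||I [[II nI] Imax]] := @noeth_maximal F; first by move=> I [].
  by exists J; split.
have bigger x : ~ I x -> good (add_gen I x).
  move=> nIx; have [AI IA Ax] := add_gen_ideal x II.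
  by apply: contrapT => nA; apply/nIx/(Imax (add_gen I x)).
have [I0 ID IM] := II.
have nI1 : ~ I 1.
  move=> I1; apply: nI.
  have noQ (Q : Spec R) : (forall x, I x -> x \in Q) -> False.
    by move=> /(_ 1 I1); rewrite idealr1.
  case: (pselect (exists Q : Spec R, True)) => [[Q0 _]|no].
    by exists 0%N, (fun=> Q0); split=> // Q /noQ.
  have zero_ideal : is_ideal [set: R] [set 0].
    by split=> //= [x y -> ->|a x _ ->]; rewrite ?addr0 ?mulr0.
  have one_mul (x y : R) : [set 1] x -> [set 1] y -> [set 1] (x * y).
    by move=> /= -> ->; rewrite mulr1.
  have disj (x : R) : [set 0] x -> ~ [set 1] x.
    by move=> /= -> /esym/eqP; rewrite oner_eq0.
  have [P [/Spec_of_set[Q _] _ _]] := prime_avoiding (erefl : [set 1] 1) one_mul zero_ideal disj.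
  by case: no; exists Q.
case: (pselect (is_prime setT I)) => [/Spec_of_set[Q EQ]|nP].
  apply: nI; exists 1%N, (fun=> Q); split=> [i _ x /EQ//|Q' IQ'].
  by exists 0%N => // x /EQ/IQ'.
apply: nP; split=> // x y _ _ Ixy; apply: contrapT => /not_orP[nx ny].
have [n [P [HP Pmin]]] := bigger x nx; have [m [P' [HP' Pmin']]] := bigger y ny.
have [_ IAx _] := add_gen_ideal x II; have [_ IAy _] := add_gen_ideal y II.
apply: nI; exists (n + m)%N, (fun i => if (i < n)%N then P i else P' (i - n)%N); split.
  move=> i lt z Iz; case: ifP => ltn; first by apply: HP => //; exact: IAx.
  apply: HP'; last exact: IAy.
  by rewrite ltn_subLR // leqNgt ltn.
move=> Q IQ; have : x * y \in Q by exact: IQ.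
have sub z : z \in Q -> forall w, add_gen I z w -> w \in Q.
  move=> zQ w [a /IQ Qw]; rewrite -[w](subrK (a * z)).
  by apply: rpredD => //; exact: idealMr.
rewrite prime_idealrM => /orP[/sub/Pmin|/sub/Pmin'] [i lt PQ].
  by exists i; [rewrite ltn_addr|rewrite lt].
exists (n + i)%N; first by rewrite ltn_add2l.
by rewrite ltnNge leq_addr /= addKn.
Qed.

End Noetherian.

(** ** Hilbert's basis theorem *)

Lemma noeth_field (k : fieldType) : noeth k.
Proof.
move=> J JI; have [J0 JD JM] := JI.
case: (pselect (exists2 x, J x & x != 0)) => [[x Jx x0]|no].
  exists [:: x]; apply/seteqP; split=> [y _|y].
    rewrite -[y](divfK x0); have [_ _ SM] := span_ideal [set` [:: x]] (@setT_subring k).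
    by apply: SM => //; apply: span_gen => //=; rewrite inE.
  by apply: span_min => // z /=; rewrite inE => /eqP ->.
exists [::]; apply/seteqP; split=> [y Jy|y]; last by apply: span_min.
have -> : y = 0 by apply: contrapT => /eqP y0; apply: no; exists y.
exact: span0.
Qed.

Section Hilbert.
Variable R : comNzRingType.

Let lead_set (s : seq {poly R}) : set R := [set` map (fun f : {poly R} => lead_coef f) s].

(** Multiply the polynomials by powers of the variable to bring all the leading
    coefficients to the same degree [d]. *)
Lemma span_lead (s : seq {poly R}) d a : {in s, forall f : {poly R}, (size f <= d.+1)%N} ->
  span setT (lead_set s) a ->
  exists g, [/\ span setT [set` s] g, (size g <= d.+1)%N & g`_d = a].
Proof.
move=> sd; have [S0 SD SM] := span_ideal [set` s] (@setT_subring {poly R}).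
elim=> [|c _ v _ /mapP[f fs ->] _ [g [Sg sg Eg]]].
  by exists 0; rewrite size_poly0 coef0.
have Sf : span setT [set` s] f by exact: span_gen.
exists (c *: ('X^(d.+1 - size f) * f) + g); split.
- by apply: (SD) => //; rewrite -mul_polyC; apply: (SM) => //; exact: SM.
- apply: leq_trans (size_polyD _ _) _; rewrite geq_max sg andbT.
  apply: leq_trans (size_scale_leq _ _) _.
  apply: leq_trans (size_polyMleq _ _) _.
  by rewrite size_polyXn addSn /= subnK // sd.
- rewrite coefD Eg coefZ coefXnM lead_coefE; congr (c * _ + v).
  have := sd f fs; case sf: (size f) => [|n]; last first.
    by rewrite ltnS => le; rewrite subSS ltnNge leq_subr /= subKn.
  by move=> _; rewrite subn0 ltnSn nth_default ?sf.
Qed.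

(** If [J] is not finitely generated, choose [F s] of least degree in [J] outside the span
    of [s], starting from the empty list. The ideals of leading coefficients
    stabilize, so that some [F s] differs from an element of the span of [s] by a
    polynomial of lower degree. *)
Theorem hilbert_basis : noeth R -> noeth {poly R}.
Proof.
move=> R_noeth J JI; have [J0 JD JM] := JI; apply: contrapT => no.
have /choice[F HF] : forall s : seq {poly R}, exists f, {in s, forall g, J g} ->
    [/\ J f, ~ span setT [set` s] f
      & forall g, J g -> ~ span setT [set` s] g -> (size f <= size g)%N].
  move=> s; case: (pselect {in s, forall g, J g}) => [sJ|n]; last by exists 0.
  have ex : exists m, `[< exists f, [/\ J f, ~ span setT [set` s] f & size f = m] >].
    apply: contrapT => no'; apply: no; exists s; apply/seteqP; split=> g; last first.
      by apply: span_min => // z /= /sJ.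
    move=> Jg; apply: contrapT => ng; apply: no'; exists (size g); apply/asboolP.
    by exists g.
  case: (ex_minnP ex) => m /asboolP[f [Jf nf <-]] fmin; exists f => _; split=> // g Jg ng.
  by apply: fmin; apply/asboolP; exists g.
pose t := fix t n := if n is m.+1 then F (t m) :: t m else [::].
have tJ n : {in t n, forall g, J g}.
  elim: n => [|n IH] g /=; first by [].
  by rewrite inE => /orP[/eqP->|/IH//]; case: (HF _ IH).
have tmono m n : (m <= n)%N -> {subset t m <= t n}.
  move=> le x; rewrite -(subnK le); elim: (n - m)%N => //= d IH xm.
  by rewrite inE IH // orbT.
have [||N HN] := @noeth_chain R R_noeth (fun n => span setT (lead_set (t n))).
- by move=> n; exact: span_ideal.
- move=> n; apply: span_mono => // x /mapP[f ft ->]; apply/mapP; exists f => //.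
  exact: tmono ft.
have [JF nF Fmin] := HF _ (tJ N).
have tsize f : f \in t N -> (size f <= size (F (t N)))%N.
  have le : (N <= N)%N by []; move: {1 3}N le => n; elim: n => // n IH le /=.
  rewrite inE => /orP[/eqP->|]; last by apply: IH; exact: ltnW.
  have [_ _ min] := HF _ (tJ n); apply: min => // Sn; apply: nF.
  by apply: (span_mono _ _ Sn) => // x /=; apply: tmono; exact: ltnW.
set f := F (t N) in JF nF Fmin tsize.
have f0 : f != 0 by apply/eqP => f0; apply: nF; rewrite f0; exact: span0.
have sf : size f = (size f).-1.+1 by rewrite prednK // size_poly_gt0.
have [||g [Sg sg Eg]] := @span_lead (t N) (size f).-1 (lead_coef f).
- by move=> h /tsize; rewrite -sf.
- by apply: (HN N.+1); apply: span_gen => //; rewrite /lead_set /= inE eqxx.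
have Jg : J g by apply: (span_min JI _ Sg) => h /= /tJ.
have : (size f <= size (f - g)%R)%N.
  apply: Fmin; first by apply: (JD) => //; exact: (is_idealN (@setT_subring _) JI).
  move=> Sfg; apply: nF; rewrite -[f](subrK g).
  by have [_ SD _] := span_ideal [set` t N] (@setT_subring {poly R}); exact: SD.
rewrite leqNgt => /negP; apply; rewrite [X in (_ < X)%N]sf ltnS.
apply/leq_sizeP => j le; rewrite coefB; have [->|ne] := eqVneq j (size f).-1.
  by rewrite Eg lead_coefE subrr.
have lt : (size f <= j)%N by rewrite sf ltn_neqAle eq_sym ne.
by rewrite !nth_default ?subrr // (leq_trans sg) // -sf.
Qed.

End Hilbert.

Lemma noeth_surjective (R B : comNzRingType) (f : {rmorphism R -> B}) :
  (forall b, exists a, f a = b) -> noeth R -> noeth B.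
Proof.
move=> fs R_noeth J JI; have [J0 JD JM] := JI.
have [|s Es] := R_noeth [set a | J (f a)].
  split=> /=; first by rewrite rmorph0.
    by move=> x y; rewrite rmorphD; exact: JD.
  by move=> a x _; rewrite rmorphM; exact: JM.
have [S0 SD SM] := span_ideal [set` map f s] (@setT_subring B).
exists (map f s); apply/seteqP; split=> b.
  have [a <-] := fs b => Jb; have : span setT [set` s] a by rewrite -Es.
  elim=> [|c u v _ us _ IH]; first by rewrite rmorph0.
  rewrite rmorphD rmorphM; apply: SD => //; apply: SM => //.
  by apply: span_gen => //=; exact: map_f.
apply: span_min => // _ /= /mapP[a sa ->].
suff : [set a | J (f a)] a by []. by rewrite Es; exact: span_gen.
Qed.

Lemma finite_type_noeth (k : fieldType) (B : comNzRingType) (iota : {rmorphism k -> B})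
    (gens : seq B) :
  (forall S : set B, subring S -> range iota `<=` S ->
    (forall g, g \in gens -> S g) -> forall b, S b) -> noeth B.
Proof.
move=> Bgen.
have [R [f [R_noeth kf gf]]] : exists (R : comNzRingType) (f : {rmorphism R -> B}),
    [/\ noeth R, range iota `<=` range f & forall g, g \in gens -> range f g].
  elim: (gens) => [|b l [R [f [R_noeth kf lf]]]].
    by exists k, iota; split=> //; exact: noeth_field.
  have cb : commr_rmorph f b by move=> x; exact: mulrC.
  have fC a : horner_morph cb a%:P = f a by exact: horner_morphC.
  exists {poly R}, (horner_morph cb); split.
  - exact: hilbert_basis.
  - by move=> _ /kf[a _ <-]; exists a%:P => //; exact: fC.
  - move=> g; rewrite inE => /orP[/eqP->|/lf[a _ <-]]; last by exists a%:P => //; exact: fC.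
    by exists 'X => //; exact: horner_morphX.
apply: (@noeth_surjective R B f) => // b.
have [a _ <-] : range f b by apply: Bgen => //; exact: image_subring.
by exists a.
Qed.

(** * Generators of a prime after localization *)

Section LocalGenerators.
Variables (B : comNzRingType) (p : set B).
Hypothesis p_prime : is_prime setT p.
Implicit Types (S T G : set B) (q : {poly B}).

Let pI : is_ideal setT p. Proof. by case: p_prime. Qed.
Let p0 : p 0. Proof. by case: pI. Qed.
Let pD x y : p x -> p y -> p (x + y). Proof. by case: pI => _ H _; exact: H. Qed.
Let pM a x : p x -> p (a * x). Proof. by case: pI => _ _ H; exact: H. Qed.
Let pN x : p x -> p (- x). Proof. exact: is_idealN (@setT_subring B) pI. Qed.
Let np1 : ~ p 1. Proof. by case: p_prime. Qed.
Let pP x y : p (x * y) -> p x \/ p y. Proof. by case: p_prime => _ _ _ H; exact: H. Qed.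
Let npM x y : ~ p x -> ~ p y -> ~ p (x * y). Proof. by move=> nx ny /pP[]. Qed.

(** [G] generates [p `&` S] after inverting the elements of [S] outside [p]. *)
Definition local_generators S G := forall u, S u -> p u ->
  exists d, [/\ S d, ~ p d & span S G (d * u)].

Lemma horner_in_p q c : coefs_in p q -> p q.[c].
Proof.
move=> pq; rewrite horner_coef; elim/big_ind: _ => //.
by move=> i _; rewrite mulrC; exact: pM.
Qed.

Lemma deriv_in_p q : coefs_in p q -> coefs_in p q^`().
Proof. by move=> pq i; rewrite coef_deriv -mulr_natl; exact: pM. Qed.

Section Step.
Variables (S G : set B) (c : B).
Hypothesis HS : subring S.
Let T := adjoin S c.
Let HT : subring T := adjoin_subring c HS.
Let ST : S `<=` T := adjoin_sub c HS.
Let Tq q : coefs_in S q -> T q.[c]. Proof. by move=> Sq; exists q. Qed.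

Lemma span_coefs_in_p q : local_generators S G -> coefs_in S q -> coefs_in p q ->
  exists d, [/\ S d, ~ p d & span T G (d * q.[c])].
Proof.
move=> Sgen; have GI := span_ideal G HT; have [G0 GD GM] := GI.
elim/poly_ind: q => [|q a IH] Sq pq.
  by exists 1; split; [exact: subring1| |rewrite horner0 mulr0].
have Eq i : (q * 'X + a%:P)`_i.+1 = q`_i by rewrite coefD coefMX coefC addr0.
have Ea : (q * 'X + a%:P)`_0 = a by rewrite coefD coefMX coefC add0r.
have [||d [Sd nd Gd]] := IH; [by move=> i; rewrite -Eq|by move=> i; rewrite -Eq|].
have [||e [Se ne Ge]] := Sgen a; [by rewrite -Ea|by rewrite -Ea|].
exists (e * d); split; [exact: subringM|exact: npM|].
have -> : e * d * (q * 'X + a%:P).[c] = e * c * (d * q.[c]) + d * (e * a).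
  by rewrite hornerD hornerM hornerX hornerC; ring_eq.
apply: GD; apply: GM => //; first by apply: (subringM HT); [exact: ST|exact: adjoin_gen].
  exact: ST.
by apply: (span_mono ST _ Ge).
Qed.

(** The polynomials over [S] whose value at [c] lies in [p] form, modulo [p] and up to
    denominators, an ideal of a polynomial ring over a field, which is principal. *)
Definition residual_generator (H : {poly B}) := [/\ coefs_in S H, p H.[c] &
  forall U, coefs_in S U -> p U.[c] -> exists d Q N,
    [/\ S d, ~ p d, coefs_in S Q, coefs_in S N /\ coefs_in p N & d *: U = H * Q + N]].

(** Pseudo-division by an element of least degree, whose leading coefficient
    is outside [p]. *)
Lemma residual_generator_exists : exists H, residual_generator H.
Proof.
have HP := coefs_in_subring HS.
pose bad H := [/\ coefs_in S H, p H.[c] & ~ coefs_in p H].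
case: (pselect (exists H, bad H)) => [[H0 badH0]|no]; last first.
  exists 0; split; [exact: (subring0 HP)|by rewrite horner0|] => U SU pU.
  exists 1, 0, U; split; rewrite ?mul0r ?add0r ?scale1r //.
  - exact: subring1.
  - exact: (subring0 HP).
  - by split=> //; apply: contrapT => nU; apply: no; exists U.
have ex : exists n, `[< exists2 H, bad H & size H = n >] by exists (size H0); apply/asboolP; exists H0.
case: (ex_minnP ex) => n /asboolP[H [SH pH nH] sH] nmin.
have Hmin U : bad U -> (n <= size U)%N by move=> bU; apply: nmin; apply/asboolP; exists U.
have Sl : S (lead_coef H) by rewrite lead_coefE.
have nl : ~ p (lead_coef H).
  move=> pl; pose H' := H - lead_coef H *: 'X^((size H).-1).
  have : (n <= size H')%N.
    apply: Hmin; split.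
    - apply: (subringB HP) => // i; rewrite coefZ; apply: (subringM HS) => //.
      exact: coefs_inXn.
    - rewrite hornerD hornerN hornerZ; apply: pD => //; apply: pN.
      by rewrite mulrC; exact: pM.
    - move=> pH'; apply: nH => i; rewrite -[H](subrK (lead_coef H *: 'X^((size H).-1))).
      by rewrite coefD coefZ; apply: pD; [exact: pH'|rewrite mulrC; exact: pM].
  rewrite leqNgt => /negP; apply; case: n sH {ex nmin Hmin} => [|n] sH.
    case: nH => i; have -> : H = 0 by apply/eqP; rewrite -size_poly_eq0 sH.
    by rewrite coef0.
  rewrite ltnS; apply/leq_sizeP => j; rewrite /H' lead_coefE sH /= coefB coefZ coefXn => le.
  have [->|ne] := eqVneq j n; first by rewrite mulr1 subrr.
  by rewrite mulr0 subr0 nth_default // sH ltn_neqAle eq_sym ne.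
exists H; split=> // U; have [m] := ubnP (size U); elim: m U => // m IH U lt SU pU.
case: (ltnP (size U) n) => [small|large].
  exists 1, 0, U; split; rewrite ?mulr0 ?add0r ?scale1r //.
  - exact: subring1.
  - exact: (subring0 HP).
  - split=> //; apply: contrapT => nU; have := Hmin U; rewrite leqNgt small.
    by move=> /(_ (And3 SU pU nU)).
have n0 : (0 < n)%N.
  rewrite lt0n -sH size_poly_eq0; apply/eqP => H0'; apply: nH => i.
  by rewrite H0' coef0.
set k := (size U - n)%N; pose M := lead_coef U *: 'X^k.
have SZ a q : S a -> coefs_in S q -> coefs_in S (a *: q).
  by move=> Sa Sq i; rewrite coefZ; exact: subringM.
have SM : coefs_in S M by apply: SZ; [rewrite lead_coefE|exact: coefs_inXn].
have [|||d [Q [N [Sd nd SQ pN' E]]]] := IH (lead_coef H *: U - H * M).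
- apply: leq_trans (_ : size U <= m)%N => //; have U0 : (0 < size U)%N by exact: leq_trans large.
  rewrite -[X in (_ < X)%N](prednK U0) ltnS; apply/leq_sizeP => j le.
  rewrite coefB coefZ -scalerAr coefZ coefMXn.
  have ltk : (j < k)%N = false.
    apply/negbTE; rewrite -leqNgt; apply: leq_trans le; rewrite /k.
    by rewrite -subn1 leq_sub2l.
  rewrite ltk; have [->|ne] := eqVneq j (size U).-1.
    have -> : ((size U).-1 - k = (size H).-1)%N.
      by rewrite sH /k -subn1 -subnDA [(1 + _)%N]addnC subnDA subKn // subn1.
    by rewrite -!lead_coefE mulrC subrr.
  have ltU : (size U <= j)%N by rewrite -(prednK U0) ltn_neqAle eq_sym ne.
  rewrite [U`_j]nth_default // [H`_ _]nth_default ?mulr0 ?subrr // sH.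
  by rewrite leq_subRL ?(leq_trans (leq_subr _ _) ltU) // subnK.
- by apply: (subringB HP); [exact: SZ|exact: (subringM HP)].
- rewrite hornerD hornerN hornerZ hornerM; apply: pD; first exact: pM.
  by apply: pN; rewrite mulrC; exact: pM.
exists (d * lead_coef H), (Q + d *: M), N; split=> //.
- exact: subringM.
- exact: npM.
- by apply: (subringD HP) => //; exact: SZ.
- by rewrite -scalerA -[_ *: U](subrK (H * M)) scalerDr E scalerAr; ring_eq.
Qed.

(** The value at [c] of a residual generator is the only generator to be added. *)
Lemma local_generators_adjoin : local_generators S G ->
  exists h, [/\ T h, p h & local_generators T (h |` G)].
Proof.
move=> Sgen; have [H [SH pH Hgen]] := residual_generator_exists.
exists H.[c]; split=> //; first exact: Tq.
move=> _ [U SU ->] pU; have [d [Q [N [Sd nd SQ [SN pN'] E]]]] := Hgen U SU pU.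
have [e [Se ne Ge]] := span_coefs_in_p Sgen SN pN'.
have [G0 GD GM] := span_ideal (H.[c] |` G) HT.
exists (e * d); split; [by apply: ST; exact: (subringM HS)|exact: npM|].
have -> : e * d * U.[c] = e * Q.[c] * H.[c] + e * N.[c].
  have := congr1 (fun q => e * q.[c]) E; rewrite hornerZ hornerD hornerM mulrA => ->.
  by ring_eq.
have GT : span T G `<=` span T (H.[c] |` G) by apply: span_mono => // x Gx; right.
apply: GD; last exact: GT.
apply: GM; first by apply: (subringM HT); [exact: ST|exact: Tq].
by apply: (span_gen HT); left.
Qed.

(** Modulo [p], the polynomial [f] is a multiple [H * Q] of a residual generator, and
    [Q.[c]] is outside [p] because [c] is a simple root. As [f.[c] = 0], the generator
    [H.[c]] is redundant. *)
Lemma local_generators_adjoin_simple f : local_generators S G ->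
  coefs_in S f -> f.[c] = 0 -> ~ p f^`().[c] -> local_generators T G.
Proof.
move=> Sgen Sf fc nf'; have [H [SH pH Hgen]] := residual_generator_exists.
have pf : p f.[c] by rewrite fc.
have [G0 GD GM] := span_ideal G HT.
have [d [Q [N [Sd nd SQ [SN pN'] E]]]] := Hgen f Sf pf.
have nQ : ~ p Q.[c].
  move=> pQ; apply: (npM nd nf').
  have := congr1 (fun q => q^`().[c]) E; rewrite derivZ hornerZ => ->.
  rewrite derivD derivM !hornerD !hornerM; apply: pD.
    by apply: pD; [exact: pM|rewrite mulrC; exact: pM].
  by apply: horner_in_p; exact: deriv_in_p.
have [e [Se ne Ge]] := span_coefs_in_p Sgen SN pN'.
have Gh : span T G (e * Q.[c] * H.[c]).
  have -> : e * Q.[c] * H.[c] = - (e * N.[c]).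
    have := congr1 (fun q => e * q.[c]) E; rewrite hornerZ fc mulr0 mulr0 hornerD hornerM.
    by move/eqP; rewrite mulrDr eq_sym addr_eq0 => /eqP <-; ring_eq.
  exact: (is_idealN HT (span_ideal G HT)).
move=> _ [U SU ->] pU; have [d' [Q' [N' [Sd' nd' SQ' [SN' pN''] E']]]] := Hgen U SU pU.
have [e' [Se' ne' Ge']] := span_coefs_in_p Sgen SN' pN''.
exists (e * Q.[c] * e' * d'); split.
- apply: (subringM HT); last exact: ST.
  by apply: (subringM HT); [apply: (subringM HT)|]; [exact: ST|exact: Tq|exact: ST].
- by apply: npM => //; apply: npM => //; exact: npM.
have -> : e * Q.[c] * e' * d' * U.[c] =
    e' * Q'.[c] * (e * Q.[c] * H.[c]) + e * Q.[c] * (e' * N'.[c]).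
  have EU : d' * U.[c] = H.[c] * Q'.[c] + N'.[c] by rewrite -[LHS]hornerZ E' hornerD hornerM.
  by rewrite -[LHS]mulrA EU; ring_eq.
apply: GD; apply: GM => //.
- by apply: (subringM HT); [exact: ST|exact: Tq].
- by apply: (subringM HT); [exact: ST|exact: Tq].
Qed.

End Step.

Lemma local_generators_units S : (forall u, S u -> p u -> u = 0) -> subring S ->
  local_generators S set0.
Proof.
move=> Sp HS u Su pu; exists 1; split; [exact: subring1|exact: np1|].
by rewrite (Sp u Su pu) mulr0; exact: span0.
Qed.

Lemma local_generators_fraction S G : local_generators S G ->
  (forall b, exists e, [/\ S e, ~ p e & S (e * b)]) -> local_generators setT G.
Proof.
move=> Sgen frac u _ pu; have [e [Se ne Seu]] := frac u.
have [d [Sd nd Gd]] := Sgen (e * u) Seu (pM e pu).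
exists (d * e); split=> //; first exact: npM.
by rewrite -mulrA; exact: (span_mono _ _ Gd).
Qed.

Lemma local_generators_simple_roots R G (l : seq B) : subring R ->
  local_generators R G ->
  (forall c, c \in l -> exists f, [/\ coefs_in R f, f.[c] = 0 & ~ p f^`().[c]]) ->
  exists S, [/\ subring S, R `<=` S, forall c, c \in l -> S c & local_generators S G].
Proof.
move=> HR Rgen; elim: l => [|c l IH] rootl; first by exists R; split.
have [|S [HS RS lS Sgen]] := IH.
  by move=> a al; apply: rootl; rewrite inE al orbT.
have [|f [Rf fc nf]] := rootl c; first by rewrite inE eqxx.
exists (adjoin S c); split.
- exact: adjoin_subring.
- by move=> x /RS; exact: adjoin_sub.
- by move=> a; rewrite inE => /orP[/eqP->|/lS]; [exact: adjoin_gen|exact: adjoin_sub].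
- by apply: (local_generators_adjoin_simple HS Sgen _ fc nf) => i; exact: RS.
Qed.

(** If [q] does not contain [a], every element of [q] is locally a multiple [e * a]
    with [e] in [q]. Choosing a nonzero element of [q] that generates a maximal local ideal,
    [e] generates the same local ideal, so that [a] is locally a unit. *)
Lemma locally_principal_no_between a (q : set B) : noeth B -> p a ->
  local_generators setT [set a] -> (forall x y : B, x * y = 0 -> x = 0 \/ y = 0) ->
  is_prime setT q -> q `<=` p -> (exists2 b, q b & b <> 0) -> p `<=` q.
Proof.
move=> B_noeth pa agen integral [[q0 qD qM] _ nq1 qP] qp [b qb b0].
have mult u : p u -> exists d e, [/\ ~ p d & d * u = e * a].
  move=> pu; have [d [_ nd Gd]] := agen u I pu; exists d.
  suff [e ->] : exists e, d * u = e * a by exists e.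
  elim: Gd => [|c x y _ -> _ [e ->]]; first by exists 0; rewrite mul0r.
  by exists (c + e); rewrite mulrDl.
have qa_p : q a -> p `<=` q.
  move=> qa u pu; have [d [e [nd E]]] := mult u pu.
  have : q (d * u) by rewrite E; exact: (qM).
  by case/(qP d u I I) => // /qp.
apply: contrapT => npq; have nqa : ~ q a by move/qa_p.
pose J x : set B := [set u | exists2 d, ~ p d & exists r, d * u = r * x].
pose F : set (set B) := [set I | exists x, [/\ q x, x <> 0 & I = J x]].
have JI x : is_ideal setT (J x).
  split; first by exists 1 => //; exists 0; rewrite mulr0 mul0r.
    move=> u v [d nd [r E]] [e ne [s E']]; exists (d * e); first exact: npM.
    exists (e * r + d * s).
    have -> : d * e * (u + v) = e * (d * u) + d * (e * v) by ring_eq.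
    by rewrite E E'; ring_eq.
  move=> c u _ [d nd [r E]]; exists d => //; exists (c * r).
  have -> : d * (c * u) = c * (d * u) by ring_eq.
  by rewrite E mulrA.
have [||I [[x [qx x0 ->]] Imax]] := @noeth_maximal B B_noeth F.
- by move=> _ [x [_ _ ->]].
- by exists (J b), b.
have [d [e [nd E]]] := mult x (qp x qx).
have qe : q e.
  have : q (e * a) by rewrite -E; exact: (qM).
  by case/(qP e a Logic.I Logic.I).
have e0 : e <> 0.
  move=> e0; case: (integral d x); first by rewrite E e0 mul0r.
    by move=> d0; apply: nd; rewrite d0.
  exact: x0.
have Fe : F (J e) by exists e.
have Jxe : J x `<=` J e.
  move=> u [f nf [s Es]]; exists (f * d); first exact: npM.
  exists (s * a); have -> : f * d * u = d * (f * u) by ring_eq.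
  rewrite Es; have -> : d * (s * x) = s * (d * x) by ring_eq.
  by rewrite E; ring_eq.
have Jee : J e e by exists 1 => //; exists 1.
have [d' nd' [r Er]] := Imax (J e) Fe Jxe e Jee.
have : e * (d * d' - r * a) = 0.
  have -> : e * (d * d' - r * a) = d * (d' * e) - r * (e * a) by ring_eq.
  by rewrite Er -E; ring_eq.
case/integral => // /eqP; rewrite subr_eq0 => /eqP Edd.
by apply: (npM nd nd'); rewrite Edd; exact: pM.
Qed.

End LocalGenerators.

(** * Regularity of localizations *)

Lemma span_generates (R : comNzRingType) (s : seq R) x : span setT [set` s] x <->
  exists c : 'I_(size s) -> R, x = \sum_i c i * s`_i.
Proof.
have SI := span_ideal [set` s] (@setT_subring R).
split=> [|[c ->]]; last first.
  apply: (is_ideal_sum SI) => i; have [_ _ SM] := SI; apply: (SM) => //.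
  by apply: span_gen => //=; exact: mem_nth.
elim=> [|a y z _ ys _ [c ->]].
  by exists (fun=> 0); rewrite big1 // => i _; rewrite mul0r.
have lt : (index y s < size s)%N by rewrite index_mem.
exists (fun i => (if i == Ordinal lt then a else 0) + c i).
rewrite (eq_bigr _ (fun i _ => mulrDl _ _ _)) big_split /=; congr (_ + _).
rewrite (bigD1 (Ordinal lt)) //= eqxx nth_index // big1 ?addr0 // => i /negbTE ->.
by rewrite mul0r.
Qed.

Lemma prime_chain_mono (R : comNzRingType) n (c : nat -> Spec R) : prime_chain n c ->
  forall i j, (i <= j)%N -> (j <= n)%N -> {subset c i <= c j}.
Proof.
move=> ch i j le; rewrite -(subnK le); elim: (j - i)%N => [_ x //|d IH lt x xi].
by apply: (ch _ lt).1; apply: IH => //; exact: ltnW.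
Qed.

Section AbstractLocalization.
Variables (B : idomainType) (R : comNzRingType) (phi : {rmorphism B -> R}) (p : Spec B).
Hypothesis phi_inj : injective phi.
Hypothesis phi_unit : forall s, s \notin p -> exists t, t * phi s = 1.
Hypothesis phi_frac : forall x, exists a s, s \notin p /\ phi s * x = phi a.
Hypothesis B_noeth : noeth B.

Lemma noeth_localization : noeth R.
Proof.
move=> J JI; have [J0 JD JM] := JI.
have [|g Eg] := B_noeth (J := [set b | J (phi b)]).
  split=> /=; first by rewrite rmorph0.
    by move=> x y; rewrite rmorphD; exact: JD.
  by move=> a x _; rewrite rmorphM; exact: JM.
have [S0 SD SM] := span_ideal [set` map phi g] (@setT_subring R).
exists (map phi g); apply/seteqP; split=> x.
  have [a [s [sp E]]] := phi_frac x; have [t Et] := phi_unit sp.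
  move=> Jx; have : span setT [set` g] a by rewrite -Eg /= -E; exact: JM.
  have -> : x = t * phi a by rewrite -E mulrA Et mul1r.
  move=> Sa; apply: (SM) => //; elim: Sa => [|c u v _ ug _ IH]; first by rewrite rmorph0.
  rewrite rmorphD rmorphM; apply: (SD) => //; apply: (SM) => //.
  by apply: span_gen => //=; exact: map_f.
apply: span_min => // _ /= /mapP[a ga ->].
have : span setT [set` g] a by exact: span_gen.
by rewrite -Eg.
Qed.

(** [q R], for [q] a prime contained in [p]. *)
Definition extension (q : {pred B}) : set R :=
  [set x | exists a s, [/\ a \in q, s \notin p & phi s * x = phi a]].

Lemma notinM s t : s \notin p -> t \notin p -> s * t \notin p.
Proof. by move=> sp tp; rewrite prime_idealrM negb_or sp. Qed.

Lemma extension_prime (q : Spec B) : {subset q <= p} -> is_prime setT (extension q).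
Proof.
move=> qp; split=> //.
- split.
  + by exists 0, 1; rewrite idealr0 idealr1 mulr0 rmorph0.
  + move=> x y [a [s [aq sp Ea]]] [b [t [bq tp Eb]]]; exists (t * a + s * b), (s * t).
    split; [by apply: rpredD; exact: idealMr|exact: notinM|].
    rewrite rmorphD !rmorphM -Ea -Eb; ring_eq.
  + move=> c x _ [a [s [aq sp Ea]]]; have [b [t [tp Eb]]] := phi_frac c.
    exists (b * a), (t * s); split; [exact: idealMr|exact: notinM|].
    by rewrite !rmorphM -Ea -Eb; ring_eq.
- move=> [a [s [aq sp]]]; rewrite mulr1 => /phi_inj E.
  by move: sp; rewrite E qp.
- move=> x y _ _ [a [s [aq sp E]]].
  have [b [t [tp Eb]]] := phi_frac x; have [c [u [up Ec]]] := phi_frac y.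
  have Ebc : s * (b * c) = t * u * a.
    apply: phi_inj; rewrite !rmorphM -E -Eb -Ec; ring_eq.
  have : s * (b * c) \in q by rewrite Ebc; exact: idealMr.
  rewrite !prime_idealrM => /orP[/qp sq|/orP[bq|cq]].
  + by rewrite sq in sp.
  + by left; exists b, t.
  + by right; exists c, u.
Qed.

Lemma extension_phi (q : Spec B) b : {subset q <= p} -> extension q (phi b) <-> b \in q.
Proof.
move=> qp; split=> [[a [s [aq sp]]]|bq]; last first.
  by exists b, 1; rewrite idealr1 rmorph1 mul1r.
rewrite -rmorphM => /phi_inj E; have : s * b \in q by rewrite E.
by rewrite prime_idealrM => /orP[/qp sq|//]; rewrite sq in sp.
Qed.

Lemma extension_unit x : ~ extension p x -> exists y, y * x = 1.
Proof.
have [a [s [sp E]]] := phi_frac x => nx.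
have ap : a \notin p by apply/negP => ap; apply: nx; exists a, s.
by have [t Et] := phi_unit ap; exists (t * phi s); rewrite -mulrA E.
Qed.

Lemma notin_unit (Q : idealr R) x y : y * x = 1 -> x \notin Q.
Proof.
by move=> E; apply/negP => /(idealMr y); rewrite E idealr1.
Qed.

Lemma contraction (Q : Spec R) : exists q : Spec B,
  (forall b, b \in q = (phi b \in Q)) /\ {subset q <= p}.
Proof.
have QP := Spec_prime Q; have [[Q0 QD QM] _ nQ1 QP'] := QP.
have [|q Eq] := @Spec_of_set B [set b | phi b \in Q].
  split=> //=.
  - split=> /=; first by rewrite rmorph0.
      by move=> x y; rewrite rmorphD; exact: QD.
    by move=> a x _; rewrite rmorphM; exact: QM.
  - by rewrite rmorph1.
  - by move=> x y _ _; rewrite rmorphM; exact: QP'.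
exists q; split=> [b|b /Eq /= bQ]; first by apply/idP/idP => /Eq.
apply: contraLR bQ => bp; have [t Et] := phi_unit bp; exact: notin_unit Et.
Qed.

(** Extension and contraction transport chains of primes contained in [p]. *)
Lemma krull_dim_localization n :
  (exists c, prime_chain n c /\ {subset c n <= p}) ->
  (forall m c, prime_chain m c -> {subset c m <= p} -> (m <= n)%N) ->
  krull_dim R n.
Proof.
move=> [c [ch cp]] bound; split.
  have /choice[e He] : forall q : Spec B, exists Q : Spec R, {subset q <= p} ->
      forall x, x \in Q <-> extension q x.
    move=> q; case: (pselect {subset q <= p}) => [/extension_prime/Spec_of_set[Q EQ]|nq].
      by exists Q.
    have [Q _] := Spec_of_set (extension_prime (fun _ => id)); by exists Q.
  have sub i : (i <= n)%N -> {subset c i <= p}.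
    by move=> le x /(prime_chain_mono ch le (leqnn n)) /cp.
  exists (fun i => e (c i)) => i lt; have [inc ninc] := ch i lt.
  have si := sub i (ltnW lt); have si' := sub i.+1 lt; split.
    move=> x /(He _ si)[a [s [ai sp E]]]; apply/(He _ si'); exists a, s.
    by split=> //; exact: inc.
  move=> H; apply: ninc => b bi; apply/(extension_phi b si)/(He _ si); apply: H.
  by apply/(He _ si'); apply/extension_phi.
move=> m C chC.
have /choice[f Hf] := contraction.
apply: (bound m (fun i => f (C i))); last exact: (Hf (C m)).2.
move=> i lt; have [inc ninc] := chC i lt; split.
  by move=> b; rewrite !(Hf _).1; exact: inc.
move=> H; apply: ninc => x xC; have [a [s [sp E]]] := phi_frac x.
have aC : a \in f (C i.+1) by rewrite (Hf _).1 -E idealMr.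
have := H a aC; rewrite (Hf _).1 -E prime_idealrM => /orP[|//].
by have [t Et] := phi_unit sp; rewrite (negbTE (notin_unit _ Et)).
Qed.

Lemma generates_localization (g : seq B) : {subset g <= p} ->
  local_generators [set x | x \in p] setT [set` g] ->
  forall x, extension p x <-> span setT [set` map phi g] x.
Proof.
move=> gp ggen x; have [S0 SD SM] := span_ideal [set` map phi g] (@setT_subring R).
have [EI _ _ _] := extension_prime (fun _ => id); split; last first.
  apply: span_min => // _ /= /mapP[a ga ->]; apply/extension_phi => //; exact: gp.
move=> [a [s [ap sp E]]]; have [d [_ nd Gd]] := ggen a I ap.
have /negP dp := nd; have [t Et] := phi_unit (notinM dp sp).
have -> : x = t * phi (d * a).
  by rewrite -[x]mul1r -Et !rmorphM -E; ring_eq.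
apply: (SM) => //; elim: Gd => [|c u v _ ug _ IH]; first by rewrite rmorph0.
rewrite rmorphD rmorphM; apply: (SD) => //; apply: (SM) => //.
by apply: span_gen => //=; exact: map_f.
Qed.

(** Numerators of generators of the maximal ideal are local generators of [p]. *)
Lemma generators_descend (s : seq R) :
  (forall x, extension p x <-> span setT [set` s] x) ->
  exists g : seq B, [/\ size g = size s, {subset g <= p}
    & local_generators [set x | x \in p] setT [set` g]].
Proof.
move=> Es; have /choice[num Hnum] : forall x, exists a, exists2 t, t \notin p & phi t * x = phi a.
  by move=> x; have [a [t [tp E]]] := phi_frac x; exists a, t.
exists (map num s); split; first exact: size_map.
  move=> _ /mapP[x xs ->]; have [t tp E] := Hnum x.
  have [b [u [bp up E']]] : extension p x by apply/Es; exact: span_gen.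
  have : u * num x \in p.
    suff -> : u * num x = t * b by exact: idealMr.
    by apply: phi_inj; rewrite !rmorphM -E -E'; ring_eq.
  by rewrite prime_idealrM (negbTE up).
have [S0 SD SM] := span_ideal [set` map num s] (@setT_subring B).
have clear y : span setT [set` s] y -> exists d v,
    [/\ d \notin p, phi v = phi d * y & span setT [set` map num s] v].
  elim=> [|c x z _ xs _ [d [v [dp Ev Sv]]]].
    by exists 1, 0; rewrite idealr1 rmorph0 mulr0.
  have [t tp Et] := Hnum x; have [f [e [ep Ee]]] := phi_frac c.
  exists (d * (e * t)), (d * f * num x + e * t * v); split.
  - by do 2?apply: notinM.
  - by rewrite rmorphD !rmorphM Ev -Et -Ee; ring_eq.
  - apply: (SD); apply: (SM) => //; apply: span_gen => //=; exact: map_f.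
move=> u _ up; have [|d [v [dp Ev Sv]]] := clear (phi u).
  by apply/Es/extension_phi.
exists d; split=> //; first exact/negP.
by move: Ev; rewrite -rmorphM => /phi_inj <-.
Qed.

Lemma regular_localization_of (g : seq B) : {subset g <= p} ->
  local_generators [set x | x \in p] setT [set` g] ->
  (forall g' : seq B, {subset g' <= p} ->
    local_generators [set x | x \in p] setT [set` g'] -> (size g <= size g')%N) ->
  (exists c, prime_chain (size g) c /\ {subset c (size g) <= p}) ->
  (forall m c, prime_chain m c -> {subset c m <= p} -> (m <= size g)%N) ->
  regular_local_ring R.
Proof.
move=> gp ggen gmin chain bound; split.
  move=> I; have [s Es] := noeth_localization (ideal_set I); exists s => x.
  by rewrite -span_generates -Es.
have [EI _ nE1 _] := extension_prime (fun _ => id).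
have [m Em] := ideal_of_set EI nE1.
have nonunit (J : idealr R) : {subset J <= m}.
  move=> x xJ; apply/Em; apply: contrapT => /extension_unit[y /(notin_unit J)].
  by rewrite xJ.
exists m, (size g); split; last 1 first.
- split=> [|s Hs].
    exists (map phi g); split; last exact: size_map.
    by move=> x; rewrite -span_generates -generates_localization.
  have [|g' [<- gp' ggen']] := @generators_descend s; last exact: gmin.
  by move=> x; rewrite span_generates -Hs Em.
- split.
    by move=> J mJ x; apply/idP/idP; [exact: nonunit|exact: mJ].
  move=> m' max x; apply/idP/idP; first exact: nonunit.
  by rewrite (max m (nonunit m')).
- exact: krull_dim_localization.
Qed.

End AbstractLocalization.

Section Localizations.
Variables (B : idomainType) (p : Spec B).

Lemma localization_subproof b : tofrac b \in in_localization p.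
Proof. by apply/asboolP; exists b, 1; rewrite idealr1 rmorph1 divr1. Qed.

Definition to_localization b : localization p := Localization (localization_subproof b).

Lemma to_localization_zmod : zmod_morphism to_localization.
Proof. by move=> x y; apply: val_inj; rewrite rmorphB /= rmorphB. Qed.
Lemma to_localization_monoid : monoid_morphism to_localization.
Proof.
split; first by apply: val_inj; rewrite rmorph1 /= rmorph1.
by move=> x y; apply: val_inj; rewrite rmorphM /= rmorphM.
Qed.
HB.instance Definition _ :=
  GRing.isZmodMorphism.Build B (localization p) to_localization to_localization_zmod.
HB.instance Definition _ :=
  GRing.isMonoidMorphism.Build B (localization p) to_localization to_localization_monoid.

Hypothesis B_noeth : noeth B.

Lemma regular_localization (g : seq B) : {subset g <= p} ->
  local_generators [set x | x \in p] setT [set` g] ->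
  (forall g' : seq B, {subset g' <= p} ->
    local_generators [set x | x \in p] setT [set` g'] -> (size g <= size g')%N) ->
  (exists c, prime_chain (size g) c /\ {subset c (size g) <= p}) ->
  (forall m c, prime_chain m c -> {subset c m <= p} -> (m <= size g)%N) ->
  regular_local_ring (localization p).
Proof.
have nz s : s \notin p -> tofrac s != 0 :> {fraction B}.
  by move=> sp; rewrite tofrac_eq0; apply: contraNneq sp => ->; exact: idealr0.
apply: (@regular_localization_of B (localization p) to_localization p) => //.
- by move=> x y /(congr1 val) /= /tofrac_inj.
- move=> s sp; have tP : (tofrac s)^-1 \in in_localization p.
    by apply/asboolP; exists 1, s; rewrite rmorph1 mul1r.
  by exists (Localization tP); apply: val_inj; rewrite rmorphM rmorph1 /= mulVf ?nz.
- move=> x; have /asboolP[a [s [sp E]]] := valP x; exists a, s; split=> //.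
  by apply: val_inj; rewrite rmorphM /= E mulrC divfK ?nz.
Qed.

Lemma domain_mul_eq0 (x y : B) : x * y = 0 -> x = 0 \/ y = 0.
Proof. by move/eqP; rewrite mulf_eq0 => /orP[]/eqP; [left|right]. Qed.

Lemma regular_at_zero : (forall x, x \in p -> x = 0) -> regular_local_ring (localization p).
Proof.
move=> p0; apply: (@regular_localization [::]) => //=.
- move=> u _ /= /p0 ->; exists 1; split; rewrite /= ?idealr1 // mulr0; exact: span0.
- by exists (fun=> p); split.
- move=> [|m] c // ch cp; case: (ch m (ltnSn m)) => _ []; move=> x /cp/p0 ->; exact: idealr0.
Qed.

Definition height_one := (exists2 x, x \in p & x != 0) /\
  forall q : Spec B, {subset q <= p} -> (exists2 x, x \in q & x != 0) -> {subset p <= q}.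

Lemma zero_Spec : exists z : Spec B, forall x, x \in z <-> x = 0.
Proof.
apply: Spec_of_set; split=> //.
- by split=> // [x y -> ->|a x _ ->]; rewrite ?addr0 ?mulr0.
- by move/eqP; rewrite oner_eq0.
- by move=> x y _ _ /domain_mul_eq0.
Qed.

Lemma chain_nonzero m (c : nat -> Spec B) i : prime_chain m c -> (0 < i <= m)%N ->
  exists2 x, x \in c i & x != 0.
Proof.
case: i => // i ch lt; apply: contrapT => no; case: (ch i lt) => _; apply=> x xc.
have [->|x0] := eqVneq x 0; first exact: idealr0.
by case: no; exists x.
Qed.

Lemma regular_height_one a : height_one -> a \in p ->
  local_generators [set x | x \in p] setT [set a] -> regular_local_ring (localization p).
Proof.
move=> [[x xp x0] ht] ap agen; apply: (@regular_localization [:: a]) => /=.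
- by move=> y; rewrite inE => /eqP->.
- rewrite (_ : [set` [:: a]] = [set a]) //; apply/seteqP.
  by split=> y; rewrite /= inE => /eqP.
- move=> [|//] _ /(_ x I xp)[d [_ nd Gd]]; exfalso; case: nd.
  have : d * x = 0 by elim: Gd => // c u v _ //.
  by move=> /domain_mul_eq0[->|/eqP]; [exact: idealr0|rewrite (negbTE x0)].
- have [z Ez] := zero_Spec; exists (fun i => if i is 0 then z else p); split=> // -[] // _.
  split; first by move=> y /Ez ->; exact: idealr0.
  by move=> /(_ x xp) /Ez /eqP; rewrite (negbTE x0).
- move=> [|[|m]] c // ch cp; have := ch 1%N isT => -[_ []] y yc.
  apply: (ht (c 1%N)); last by apply: cp; apply: (prime_chain_mono ch _ (leqnn _)) yc.
    by move=> z zc; apply: cp; apply: (prime_chain_mono ch _ (leqnn _)) zc.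
  exact: (chain_nonzero ch).
Qed.

(** One generator would not be enough, since [q] lies strictly between zero and [p]. *)
Lemma regular_height_two (q : Spec B) a b : krull_dim B 2 ->
  {subset q <= p} -> ~ {subset p <= q} -> (exists2 x, x \in q & x != 0) ->
  a \in p -> b \in p ->
  local_generators [set x | x \in p] setT [set` [:: a; b]] ->
  regular_local_ring (localization p).
Proof.
move=> [_ dim2] qp npq [x xq x0] ap bp abgen; apply: (@regular_localization [:: a; b]) => //=.
- by move=> y; rewrite !inE => /orP[]/eqP->.
- move=> [|c [|//]] gp cgen //.
    have [d [_ nd Gd]] := cgen x I (qp x xq); exfalso; case: nd.
    have : d * x = 0 by elim: Gd => // e u v _ //.
    by move=> /domain_mul_eq0[->|/eqP]; [exact: idealr0|rewrite (negbTE x0)].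
  exfalso; apply: npq.
  apply: (@locally_principal_no_between B _ (Spec_prime p) c [set y | y \in q]) => //.
  - by apply: gp; rewrite inE.
  - move=> u Su pu; have [d [Sd nd Gd]] := cgen u Su pu; exists d; split=> //.
    by apply: (span_mono _ _ Gd) => // y /=; rewrite inE => /eqP.
  - exact: domain_mul_eq0.
  - exact: Spec_prime.
  - by exists x => //; exact/eqP.
- have [z Ez] := zero_Spec; exists (fun i => if i is j.+1 then if j is 0 then q else p else z).
  split=> // -[|[|//]] _.
    split; first by move=> y /Ez ->; exact: idealr0.
    by move=> /(_ x xq) /Ez /eqP; rewrite (negbTE x0).
  by split.
- by move=> m c ch _; exact: dim2 ch.
Qed.

End Localizations.

(** * Surfaces with trivial Makar-Limanov invariant *)

Section Surface.
Variables (k : fieldType) (B : idomainType) (iota : {rmorphism k -> B}).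
Hypothesis k_char0 : [pchar k]%R =i pred0.
Hypothesis B_M : class_M iota.

Let k0 : set B := range iota.

Let k0_subring : subring k0. Proof. exact: image_subring. Qed.

Let dim2 : krull_dim B 2. Proof. by case: B_M. Qed.

Let k0_unit u : k0 u -> u != 0 -> exists v, u * v = 1.
Proof.
move=> [a _ <-]; rewrite fmorph_eq0 => a0; exists (iota a^-1).
by rewrite -rmorphM mulfV // rmorph1.
Qed.

Let char0 n : n.+1%:R != 0 :> B.
Proof. by rewrite -(rmorph_nat iota) fmorph_eq0 (pcharf0P k).1. Qed.

Let nat_unit n : exists v : B, n.+1%:R * v = 1.
Proof. by apply: k0_unit => //; exact: subring_nat. Qed.

Let k0_kernel (D : {additive B -> B}) : LND B D -> k0 `<=` kernel D.
Proof. by move=> D_LND u; rewrite /k0; case: B_M => _ _ <- /(_ D D_LND). Qed.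

Let generators : exists gens : seq B, forall S : set B, subring S -> k0 `<=` S ->
  (forall g, g \in gens -> S g) -> forall b, S b.
Proof.
have [[gens Hg] _ _] := B_M; exists gens => S [S1 SB SM] kS gS b.
apply/asboolP; apply: (Hg (fun b => `[< S b >])).
- split; first exact/asboolP.
    by move=> x y /asboolP Sx /asboolP Sy; apply/asboolP; exact: SB.
  by move=> x y /asboolP Sx /asboolP Sy; apply/asboolP; exact: SM.
- by move=> a; apply/asboolP/kS; exists a.
- by move=> g gg; apply/asboolP/gS.
Qed.

Let B_noeth : noeth B.
Proof. by have [gens Hg] := generators; exact: finite_type_noeth Hg. Qed.

Let k0_notin (p : Spec B) u : k0 u -> u \in p -> u = 0.
Proof.
move=> ku up; apply: contrapT => /eqP/(k0_unit ku)[v E].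
by have := idealMr v up; rewrite mulrC E idealr1.
Qed.

Lemma constants_algebraically_closed x : algebraic_over k0 x -> k0 x.
Proof.
move=> ax; have [_ _ Eml] := B_M; rewrite /k0 -Eml => D D_LND.
apply: (kernel_algebraically_closed D_LND char0).
by apply: algebraic_over_sub ax; exact: k0_kernel.
Qed.

(** A slice is transcendental over the kernel, so that [x], [z] and a slice would be
    algebraically independent if the conclusion failed. *)
Lemma kernel_algebraic (D : {additive B -> B}) b x z : LND B D -> D b != 0 ->
  kernel D x -> ~ k0 x -> kernel D z -> algebraic_over (adjoin k0 x) z.
Proof.
move=> D_LND Db Dx nkx Dz; apply: contrapT => /transcendental0 tz.
have [s [Ds Ks]] := local_slice D_LND Db; have HK := kernel_subring D_LND.
have [gens Hg] := generators.
apply: (dim2_dependent Hg nat_unit dim2 k0_subring _ tz (z := s)).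
  by apply/transcendental0 => /constants_algebraically_closed.
apply/transcendental0 => ts; move/eqP: Ds; apply.
apply: (kernel_algebraically_closed D_LND char0); apply: algebraic_over_sub ts.
by apply: adjoin_min => //; apply: adjoin_min => //; exact: k0_kernel.
Qed.

Lemma kernel_fraction (D : {additive B -> B}) (p : Spec B) s b : LND B D ->
  D s \notin p -> kernel D (D s) -> exists e q,
  [/\ e \notin p, kernel D e, coefs_in (kernel D) q & e * b = q.[s]].
Proof.
move=> D_LND sp Ks; have [m [M [q [Kq Eq]]]] := slice_expansion D_LND b Ks.
have HK := kernel_subring D_LND.
exists (m.+1%:R * D s ^+ M), q; split=> //.
- rewrite prime_idealrM negb_or; apply/andP; split.
    by apply/negP => /(k0_notin (subring_nat k0_subring m.+1))/eqP; rewrite (negbTE (char0 m)).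
  elim: M {Eq} => [|M IH]; first by rewrite expr0 idealr1.
  by rewrite exprS prime_idealrM negb_or sp.
- by apply: (subringM HK); [exact: (subring_nat HK)|exact: (subringX HK)].
Qed.

(** All the nonzero elements of the kernel are inverted in the local ring, which is therefore
    a localization of the ring of polynomials in a slice over a field. *)
Lemma kernel_avoiding_principal (D : {additive B -> B}) (p : Spec B) b : LND B D ->
  D b != 0 -> (forall u, kernel D u -> u \in p -> u = 0) ->
  exists2 h, h \in p & local_generators [set x | x \in p] setT [set h].
Proof.
move=> D_LND Db Dp; have [s [Ds Ks]] := local_slice D_LND Db.
have HK := kernel_subring D_LND; have pP := Spec_prime p.
have sp : D s \notin p by apply: contraNN Ds => /(Dp _ Ks) ->.
have [h [_ hp hgen]] := local_generators_adjoin pP s HK (local_generators_units pP Dp HK).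
exists h => //; rewrite -[[set h]]setU0; apply: (local_generators_fraction pP hgen) => z.
have [e [q [ep Ke Kq Eq]]] := kernel_fraction z D_LND sp Ks.
by exists e; split; [exact: adjoin_sub|exact/negP|exists q].
Qed.

(** If the kernel were the field of constants, [B] would be a ring of polynomials in one
    variable, whose nonzero primes are maximal. *)
Lemma kernel_nonconstant (D : {additive B -> B}) b : LND B D -> D b != 0 ->
  exists2 x, kernel D x & ~ k0 x.
Proof.
move=> D_LND Db; apply: contrapT => no.
have Kk0 u : kernel D u -> k0 u by move=> Ku; apply: contrapT => nu; apply: no; exists u.
have [[c ch] _] := dim2.
have [h hp hgen] := kernel_avoiding_principal D_LND Db (fun u Ku => @k0_notin (c 2%N) u (Kk0 u Ku)).
have [inc ninc] := ch 1%N isT; apply: ninc.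
apply: (locally_principal_no_between (Spec_prime (c 2%N)) B_noeth hp hgen (@domain_mul_eq0 B)
  (Spec_prime (c 1%N)) inc).
by have [|x x1 x0] := chain_nonzero (i := 1) ch; last by exists x => //; exact/eqP.
Qed.

(** The second derivation is one that moves a nonconstant element of the kernel of
    the first. *)
Lemma exists_LND : exists (D E : {additive B -> B}) (x : B),
  [/\ LND B D, LND B E, exists b, D b != 0, kernel D x & E x != 0].
Proof.
have [_ _ Eml] := B_M.
have moved u : ~ k0 u -> exists2 D, LND B D & D u != 0.
  rewrite /k0 -Eml => nu; apply: contrapT => no; apply: nu => D D_LND /=.
  by apply: contrapT => /eqP Du; apply: no; exists D.
have [u nu] : exists u, ~ k0 u.
  apply: contrapT => no; have [[c ch] _] := dim2.
  have [|x x1 x0] := chain_nonzero (i := 1) ch; first by [].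
  move/eqP: x0; apply; apply: (k0_notin _ x1); apply: contrapT => nx.
  by apply: no; exists x.
have [D D_LND Du] := moved u nu.
have [x Dx nx] := kernel_nonconstant D_LND Du; have [E E_LND Ex] := moved x nx.
by exists D, E, x; split=> //; exists u.
Qed.

(** In characteristic zero a relation of least degree is separable. *)
Lemma separable_relation (S : set B) c : subring S -> algebraic_over S c ->
  exists f, [/\ coefs_in S f, f.[c] = 0 & f^`().[c] != 0].
Proof.
move=> HS [f []]; have [n] := ubnP (size f); elim: n f => // n IH f lt Sf f0 fc.
have [f'c|nz] := eqVneq f^`().[c] 0; last by exists f.
apply: (IH f^`()) => //.
- by rewrite (leq_trans (lt_size_deriv f0)) // -ltnS.
- by move=> i; rewrite coef_deriv -mulr_natr; apply: (subringM HS) => //; exact: subring_nat.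
- apply: contraNneq f0 => /(deriv_char0_eq0 char0)/size1_polyC E.
  by move: fc; rewrite E hornerC => ->.
Qed.

(** Fix a slice [s], and finitely many elements [c] of the kernel, [D s] among them, that
    suffice to express generators of [B] as polynomials in [s] with denominators powers
    of [D s]. Each [c] has a separable relation [f] over [k0[x]], and [a] is the product
    of [D s] and of the values [f'(c)]. Where [a] does not vanish, [B] is
    unramified over [k0[x, s]], a ring of polynomials in two variables, and inherits its
    local generators. *)
Lemma kernel_regular_locus (D : {additive B -> B}) b : LND B D -> D b != 0 ->
  exists a, [/\ kernel D a, a != 0 & forall p q : Spec B, a \notin p ->
    {subset q <= p} -> ~ {subset p <= q} -> (exists2 x, x \in q & x != 0) ->
    regular_local_ring (localization p)].
Proof.
move=> D_LND Db; have [s [Ds Ks]] := local_slice D_LND Db.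
have HK := kernel_subring D_LND; have [x Kx nx] := kernel_nonconstant D_LND Db.
have [gens Hg] := generators.
have HR : subring (adjoin k0 x) := adjoin_subring x k0_subring.
have RK : adjoin k0 x `<=` kernel D.
  by apply: adjoin_min => //; exact: k0_kernel.
have /choice[rel Hrel] : forall c, exists f, kernel D c ->
    [/\ coefs_in (adjoin k0 x) f, f.[c] = 0 & f^`().[c] != 0].
  move=> c; case: (pselect (kernel D c)) => [Kc|]; last by exists 0.
  have [f Hf] := separable_relation HR (kernel_algebraic D_LND Db Kx nx Kc).
  by exists f.
have /choice[ex Hex] : forall g, exists q, coefs_in (kernel D) q /\
    exists m M, m.+1%:R * D s ^+ M * g = q.[s].
  move=> g; have [m [M [q [Kq Eq]]]] := slice_expansion D_LND g Ks.
  by exists q; split=> //; exists m, M.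
pose cs : seq B := D s :: flatten [seq polyseq (ex g) | g <- gens].
have Kcs c : c \in cs -> kernel D c.
  rewrite inE => /orP[/eqP->//|/flattenP[_ /mapP[g _ ->] cg]].
  by rewrite -(nth_index 0 cg); exact: (Hex g).1.
pose a := D s * \prod_(c <- cs) (rel c)^`().[c].
exists a; split.
- apply: (subringM HK) => //; rewrite big_seq; elim/big_ind: _.
  + exact: subring1.
  + by move=> u v; exact: subringM.
  + move=> c /Kcs Kc; have [Rc _ _] := Hrel c Kc; apply: (subring_horner HK) => // i.
    rewrite coef_deriv -mulr_natr; apply: (subringM HK); first exact/RK/Rc.
    exact: (subring_nat HK).
- rewrite mulf_neq0 // prodf_seq_neq0; apply/allP => c /Kcs Kc.
  by case: (Hrel c Kc).
move=> p q; rewrite prime_idealrM negb_or => /andP[sp cp] qp npq nzq.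
have pP := Spec_prime p.
have simple c : c \in cs -> ~ (rel c)^`().[c] \in p.
  move=> ccs rp; move/negP: cp; apply; elim: (cs) ccs => // d l IH.
  rewrite inE big_cons prime_idealrM => /orP[/eqP <-|/IH ->]; first by rewrite rp.
  by rewrite orbT.
have gen0 := local_generators_units pP (fun u ku => @k0_notin p u ku) k0_subring.
have [h1 [_ h1p gen1]] := local_generators_adjoin pP x k0_subring gen0.
have [|S [HS RS csS gen2]] := local_generators_simple_roots (l := cs) pP HR gen1.
  move=> c ccs; exists (rel c); have [Rc rc _] := Hrel c (Kcs c ccs).
  by split=> //; exact: simple.
have [h2 [_ h2p gen3]] := local_generators_adjoin pP s HS gen2.
have HT := adjoin_subring s HS.
have ST : S `<=` adjoin S s := adjoin_sub s HS.
have kS : k0 `<=` S by move=> u ku; apply: RS; exact: adjoin_sub.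
have Dsp M : D s ^+ M \notin p.
  elim: M => [|M IH]; first by rewrite expr0 idealr1.
  by rewrite exprS prime_idealrM negb_or sp.
have natp m : m.+1%:R \notin p.
  by apply/negP => /(k0_notin (subring_nat k0_subring m.+1))/eqP; rewrite (negbTE (char0 m)).
have SDs : S (D s) by apply: csS; rewrite inE eqxx.
have Sden m M : S (m.+1%:R * D s ^+ M).
  by apply: (subringM HS); [exact: subring_nat|exact: subringX].
have frac z : exists e, [/\ adjoin S s e, ~ e \in p & adjoin S s (e * z)].
  apply: (Hg (fun z => exists e, [/\ adjoin S s e, ~ e \in p & adjoin S s (e * z)])).
  - split; first by exists 1; rewrite idealr1 mul1r; split=> //; exact: subring1.
      move=> u v [e [Te ne Teu]] [f [Tf nf Tfv]]; exists (e * f); split.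
      + exact: subringM.
      + by rewrite prime_idealrM => /orP[].
      + have -> : e * f * (u - v) = f * (e * u) - e * (f * v) by ring_eq.
        by apply: (subringB HT); exact: subringM.
    move=> u v [e [Te ne Teu]] [f [Tf nf Tfv]]; exists (e * f); split.
    + exact: subringM.
    + by rewrite prime_idealrM => /orP[].
    + have -> : e * f * (u * v) = (e * u) * (f * v) by ring_eq.
      exact: subringM.
  - move=> u ku; exists 1; rewrite idealr1 mul1r; split=> //; first exact: subring1.
    exact/ST/kS.
  move=> g gg; have [Kg [m [M Eg]]] := Hex g; exists (m.+1%:R * D s ^+ M); split.
  - exact/ST/Sden.
  - by apply/negP; rewrite prime_idealrM negb_or natp Dsp.
  rewrite Eg; exists (ex g) => // i; case: (ltnP i (size (ex g))) => [lt|le].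
    apply: csS; rewrite inE; apply/orP; right; apply/flattenP; exists (polyseq (ex g)).
      exact: map_f.
    exact: mem_nth.
  by rewrite nth_default //; exact: subring0.
have gen4 := local_generators_fraction pP gen3 frac.
apply: (regular_height_two B_noeth dim2 qp npq nzq h2p h1p) => //.
move=> u Su pu; have [d [Sd nd Gd]] := gen4 u Su pu; exists d; split=> //.
apply: (span_mono _ _ Gd) => // y.
by case=> [->|[->|[]]]; rewrite /= !inE eqxx ?orbT.
Qed.

Lemma not_height_one (p : Spec B) : (exists2 x, x \in p & x != 0) -> ~ height_one p ->
  exists q : Spec B, [/\ {subset q <= p}, ~ {subset p <= q} & exists2 x, x \in q & x != 0].
Proof.
move=> nz nh; apply: contrapT => no; apply: nh; split=> // q qp nzq.
by apply: contrapT => npq; apply: no; exists q.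
Qed.

Lemma chain_of_length_two (p q : Spec B) : {subset q <= p} -> ~ {subset p <= q} ->
  (exists2 x, x \in q & x != 0) ->
  exists c, [/\ prime_chain 2 c, c 1%N = q & c 2%N = p].
Proof.
move=> qp npq [x xq x0]; have [z Ez] := zero_Spec B.
exists (fun i => if i is j.+1 then if j is 0 then q else p else z); split=> // -[|[|//]] _.
  split; first by move=> y /Ez ->; exact: idealr0.
  by move=> /(_ x xq) /Ez /eqP; rewrite (negbTE x0).
by split.
Qed.

Section TwoKernels.
Variables (D E : {additive B -> B}) (x0 b : B).
Hypotheses (D_LND : LND B D) (E_LND : LND B E).
Hypotheses (Db : D b != 0) (Dx0 : kernel D x0) (Ex0 : E x0 != 0).

(** As [p] is minimal over [x], a power of [y] is a multiple of [x] in the local ring at [p],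
    which [kernels_separate] forbids. *)
Lemma height_one_kernels (p : Spec B) x y : height_one p ->
  x \in p -> y \in p -> x != 0 -> y != 0 -> kernel D x -> kernel E y -> False.
Proof.
move=> [_ ht] xp yp x0' y0 Dx Ey.
have HKE := kernel_subring E_LND.
have nk z : z \in p -> z != 0 -> ~ k0 z.
  by move=> zp z0 /k0_notin/(_ zp)/eqP; rewrite (negbTE z0).
have x0_moved z : z \in p -> z != 0 -> kernel D z -> E z != 0.
  move=> zp z0 Dz; apply/eqP => Ez; move/eqP: Ex0; apply.
  apply: (kernel_algebraically_closed E_LND char0).
  apply: (algebraic_over_sub _ (kernel_algebraic D_LND Db Dz (nk z zp z0) Dx0)).
  by apply: adjoin_min => //; exact: k0_kernel.
have Ex := x0_moved x xp x0' Dx.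
have Dy : D y != 0.
  by apply/eqP => Dy; have := x0_moved y yp y0 Dy; rewrite Ey eqxx.
have [d [n [z [nd Edz]]]] : exists d n z, d \notin p /\ d * y ^+ n = x * z.
  apply: contrapT => no.
  pose T : set B := [set t | exists d n, d \notin p /\ t = d * y ^+ n].
  pose J : set B := [set u | exists z, u = x * z].
  have JI : is_ideal setT J.
    split; first by exists 0; rewrite mulr0.
      by move=> u v [w ->] [w' ->]; exists (w + w'); rewrite mulrDr.
    by move=> a u _ [w ->]; exists (a * w); rewrite mulrCA.
  have T1 : T 1 by exists 1, 0%N; rewrite idealr1 mulr1.
  have TM u v : T u -> T v -> T (u * v).
    move=> [d [n [nd ->]]] [e [m [ne ->]]]; exists (d * e), (n + m)%N.
    by rewrite prime_idealrM negb_or nd ne exprD mulrACA.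
  have JT u : J u -> ~ T u.
    by move=> [z Ez] [d [n [nd E']]]; apply: no; exists d, n, z; rewrite -E' -Ez.
  have [P [/Spec_of_set[q Eq] JP PT]] := prime_avoiding B_noeth T1 TM JI JT.
  have qp : {subset q <= p}.
    move=> u /Eq Pu; apply: contrapT => /negP nu; apply: (PT u Pu).
    by exists u, 0%N; rewrite mulr1.
  have xq : x \in q by apply/Eq/JP; exists 1; rewrite mulr1.
  have /Eq Py : y \in q by apply: ht => //; exists x.
  by apply: (PT y Py); exists 1, 1%N; rewrite idealr1 mul1r.
move/negP: nd; apply.
have kernel_alg a : kernel E a -> algebraic_over (adjoin k0 y) a.
  by move=> Ea; exact: (kernel_algebraic E_LND Ex0 Ey (nk y yp y0) Ea).
exact: (kernels_separate char0 D_LND E_LND k0_unit (k0_kernel D_LND)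
  (Spec_prime p) xp yp Dx Ey Ex Dy kernel_alg Edz).
Qed.

Lemma height_one_regular (p : Spec B) : height_one p ->
  regular_local_ring (localization p).
Proof.
move=> ht; case: (pselect (forall u, kernel D u -> u \in p -> u = 0)) => [Dp|nD].
  have [h hp hgen] := kernel_avoiding_principal D_LND Db Dp.
  exact: (regular_height_one B_noeth ht hp hgen).
case: (pselect (forall u, kernel E u -> u \in p -> u = 0)) => [Ep|nE].
  have [h hp hgen] := kernel_avoiding_principal E_LND Ex0 Ep.
  exact: (regular_height_one B_noeth ht hp hgen).
have meets F : ~ (forall u, kernel F u -> u \in p -> u = 0) ->
    exists u, [/\ kernel F u, u \in p & u != 0].
  move=> nF; apply: contrapT => no; apply: nF => u Fu up.
  by apply: contrapT => /eqP u0; apply: no; exists u.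
have [x [Dx xp x0']] := meets D nD; have [y [Ey yp y0]] := meets E nE.
by case: (height_one_kernels ht xp yp x0' y0 Dx Ey).
Qed.

(** A singular [p] contains the elements [a] and [c] attached to the two kernels. It is
    a minimal prime over the ideal that they generate: a smaller prime containing both
    would have height one. *)
Lemma Sing_finite : finite_set (Sing B).
Proof.
have [a [Da a0 areg]] := kernel_regular_locus D_LND Db.
have [c [Ec c0 creg]] := kernel_regular_locus E_LND Ex0.
have [n [P [HP Pmin]]] := finite_minimal_primes B_noeth
  (span_ideal [set` [:: a; c]] (@setT_subring B)).
apply: (@sub_finite_set _ _ (P @` `I_n)); last exact/finite_image/finite_II.
move=> p sing.
have nz : exists2 x, x \in p & x != 0.
  apply: contrapT => no; apply: sing; apply: (regular_at_zero B_noeth) => x xp.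
  by apply: contrapT => /eqP x0'; apply: no; exists x.
have [q [qp npq nzq]] : exists q : Spec B,
    [/\ {subset q <= p}, ~ {subset p <= q} & exists2 x, x \in q & x != 0].
  by apply: not_height_one => // /height_one_regular.
have ap : a \in p by apply: contrapT => /negP nap; exact/sing/(areg p q).
have cp : c \in p by apply: contrapT => /negP ncp; exact/sing/(creg p q).
have [|i lt Pip] := Pmin p.
  apply: span_min; first by case: (Spec_prime p).
  by move=> x /=; rewrite !inE => /orP[]/eqP->.
have inP z : z \in [:: a; c] -> z \in P i.
  by move=> zac; apply: HP => //; exact: span_gen.
have aP : a \in P i by apply: inP; rewrite !inE eqxx.
have cP : c \in P i by apply: inP; rewrite !inE eqxx orbT.
exists i => //; apply: Spec_ext => x; apply/idP/idP; first exact: Pip.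
move: x; apply: contrapT => npP.
suff htP : height_one (P i) by case: (height_one_kernels htP aP cP a0 c0 Da Ec).
split=> [|q' q'P nzq']; first by exists a.
apply: contrapT => nPq'; have [ch [chain _ E2]] := chain_of_length_two q'P nPq' nzq'.
suff : (3 <= 2)%N by [].
apply: (dim2.2 3%N (fun j => if j == 3 then p else ch j)) => -[|[|[|//]]] _ /=.
- exact: chain 0%N isT.
- exact: chain 1%N isT.
- by rewrite E2.
Qed.

End TwoKernels.

Lemma height_height_one (p : Spec B) : height p 1 -> height_one p.
Proof.
move=> [[c [ch Ec]] bound]; split.
  have [|x xc x0] := chain_nonzero (i := 1) ch; first by [].
  by exists x; rewrite -?Ec.
move=> q qp nzq; apply: contrapT => npq.
have [c' [ch' _ E]] := chain_of_length_two qp npq nzq.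
by have := bound 2%N c' ch'; rewrite E => /(_ (fun _ => erefl)).
Qed.

End Surface.

Theorem corollary4p11 (k : fieldType) (k_char0 : [pchar k]%R =i pred0)
    (B : idomainType) (iota : {rmorphism k -> B}) (B_M : class_M iota) :
  finite_set (Sing B) /\ regular_in_codim1 B.
Proof.
have [D [E [x [D_LND E_LND [b Db] Dx Ex]]]] := exists_LND k_char0 B_M.
split; first exact: (Sing_finite k_char0 B_M D_LND E_LND Db Dx Ex).
move=> p /height_height_one.
exact: (height_one_regular k_char0 B_M D_LND E_LND Db Dx Ex).
Qed.
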